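(* Let $K$ be a field, let $m\ge3$ and $l\ge2$ be integers, let $Q_m$ be the quiver $$m\xrightarrow{a_{m-1}}m-1\xrightarrow{a_{m-2}}m-2\xrightarrow{a_{m-3}}\cdots\xrightarrow{a_2}2\xrightarrow{a_1}1,$$ and let $\Lambda_{m,l}=KQ_m/(\mathrm{rad}\,KQ_m)^l$. Let $n$ be an integer with $2\le n\le \mathrm{gl.dim.}\,\Lambda_{m,l}$. Then $\Lambda_{m,l}$ admits an $n$-cluster tilting subcategory if and only if one of the following holds: (i) $l=2$ and $m=nk+1$ for some integer $k\ge0$; or (ii) $n$ is even and $m=\frac n2l+1+k(nl-l+2)$ for some integer $k\ge0$.
   Context: For a finite-dimensional algebra $\Lambda$, $\mathrm{mod}\,\Lambda$ is the category of finitely generated right $\Lambda$-modules. A full subcategory $\mathcal{C}$ of $\mathrm{mod}\,\Lambda$ closed under direct sums and summands is an $n$-cluster tilting subcategory if it is functorially finite (every $M\in\mathrm{mod}\,\Lambda$ has a left and a right $\mathcal{C}$-approximation) and $\mathcal{C}=\{X\mid \mathrm{Ext}^i_\Lambda(\mathcal{C},X)=0 \text{ for all } 0<i<n\}=\{X\mid \mathrm{Ext}^i_\Lambda(X,\mathcal{C})=0\text{ for all }0<i<n\}$. ''$\Lambda$ admits an $n$-cluster tilting subcategory'' means that $\mathrm{mod}\,\Lambda$ has such a subcategory. *)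

(* Defs.v *)
From HB Require Import structures.
From mathcomp Require Import all_boot all_algebra.
From mathcomp Require Import finmap.
From mathcomp Require Import generic_quotient ring_quotient.
From mathcomp Require Import boolp.
From mathcomp Require Import monalg.

Set Implicit Arguments.
Unset Strict Implicit.
Unset Printing Implicit Defensive.

Import GRing.Theory.

Local Open Scope ring_scope.

Record quiver := Quiver {
  vert : finType;
  arr : finType;
  src : arr -> vert;
  tgt : arr -> vert }.

Section Paths.
Variable Q : quiver.

(* [walk v s]: the arrows of [s], traversed from left to right, form a path
   starting at [v]; the empty list is the stationary path at [v]. *)
Fixpoint walk (v : vert Q) (s : seq (arr Q)) : bool :=
  if s is a :: s' then (src a == v) && walk (tgt a) s' else true.

Fixpoint walk_end (v : vert Q) (s : seq (arr Q)) : vert Q :=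
  if s is a :: s' then walk_end (tgt a) s' else v.

Record qpath := QPath {
  qpath_val : vert Q * seq (arr Q);
  qpath_walk : walk qpath_val.1 qpath_val.2 }.

HB.instance Definition _ := [isSub for qpath_val].
HB.instance Definition _ := [Choice of qpath by <:].

Definition qsrc (p : qpath) : vert Q := (qpath_val p).1.
Definition qarrows (p : qpath) : seq (arr Q) := (qpath_val p).2.
Definition qtgt (p : qpath) : vert Q := walk_end (qsrc p) (qarrows p).

Definition qtriv (v : vert Q) : qpath := @QPath (v, [::]) isT.

Lemma walk_cat v s t : walk v (s ++ t) = walk v s && walk (walk_end v s) t.
Proof. by elim: s v => //= a s IHs v; rewrite IHs andbA. Qed.

Lemma walk_end_cat v s t : walk_end v (s ++ t) = walk_end (walk_end v s) t.
Proof. by elim: s v => /=. Qed.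

(* [qcat p q] is "first [p], then [q]" when [p] ends where [q] starts;
   otherwise the product of [p] and [q] in the path algebra is 0. With this
   convention right modules over the path algebra of [Q] are the
   representations of [Q]. *)
Definition qcat (p q : qpath) : option qpath :=
  if qtgt p == qsrc q then insub (qsrc p, qarrows p ++ qarrows q) else None.

Lemma qpath_eq (p q : qpath) : qsrc p = qsrc q -> qarrows p = qarrows q -> p = q.
Proof.
move=> e1 e2; apply: val_inj => /=; move: e1 e2.
rewrite /qsrc /qarrows.
by case: (qpath_val p) (qpath_val q) => [a b] [c d] /= -> ->.
Qed.

Lemma qcatP p q : qtgt p = qsrc q ->
  exists2 r, qcat p q = Some r &
    [/\ qsrc r = qsrc p, qarrows r = qarrows p ++ qarrows q & qtgt r = qtgt q].
Proof.
move=> e; rewrite /qcat e eqxx.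
case: insubP => [r _ rE|] /=; last first.
  by rewrite walk_cat (qpath_walk p) /= -/(qtgt p) e (qpath_walk q).
exists r => //; rewrite /qtgt /qsrc /qarrows rE /=; split=> //.
by rewrite walk_end_cat -/(qtgt p) e.
Qed.

Lemma qcatN p q : qtgt p != qsrc q -> qcat p q = None.
Proof. by rewrite /qcat => /negbTE ->. Qed.

Lemma qcatA p q r : obind (qcat p) (qcat q r) = obind (qcat^~ r) (qcat p q).
Proof.
have [eqr|nqr] := eqVneq (qtgt q) (qsrc r); last first.
  rewrite (qcatN nqr) /=.
  have [epq|npq] := eqVneq (qtgt p) (qsrc q); last by rewrite (qcatN npq).
  have [s -> [_ _ e]] /= := qcatP epq.
  by rewrite qcatN // e.
have [s sE [s1 s2 s3]] := qcatP eqr; rewrite sE /=.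
have [epq|npq] := eqVneq (qtgt p) (qsrc q); last first.
  by rewrite (qcatN npq) /= qcatN // s1.
have [t tE [t1 t2 t3]] := qcatP epq; rewrite tE /=.
have [|u -> [u1 u2 _]] := @qcatP p s; first by rewrite s1.
have [|w -> [w1 w2 _]] := @qcatP t r; first by rewrite t3.
congr Some; apply: qpath_eq; first by rewrite u1 w1.
by rewrite u2 w2 s2 t2 catA.
Qed.

Lemma qcat1p v p : qcat (qtriv v) p = if qsrc p == v then Some p else None.
Proof.
have [e|ne] := eqVneq (qsrc p) v; last by rewrite qcatN // eq_sym.
have [|r -> [r1 r2 _]] := @qcatP (qtriv v) p; first by rewrite e.
by congr Some; apply: qpath_eq; rewrite ?r1 ?r2.
Qed.

Lemma qcatp1 v p : qcat p (qtriv v) = if qtgt p == v then Some p else None.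
Proof.
have [e|ne] := eqVneq (qtgt p) v; last by rewrite qcatN.
have [|r -> [r1 r2 _]] := @qcatP p (qtriv v); first by rewrite e.
by congr Some; apply: qpath_eq; rewrite ?r1 ?r2 //= cats0.
Qed.

End Paths.

(* Finitely supported functions from paths to [K]; [<< c *g p >>] is the
   element [c p]. *)
Definition path_alg (K : fieldType) (Q : quiver) : Type := {malg K[qpath Q]}.

Section PathAlgebra.
Variables (K : fieldType) (Q : quiver).
Local Notation KQ := (path_alg K Q).

HB.instance Definition _ := GRing.Lmodule.on KQ.

Definition path_mul1 (c : K) (p q : qpath Q) : KQ :=
  if qcat p q is Some r then << c *g r >> else 0.

Definition path_mul (f g : KQ) : KQ :=
  \sum_(p <- msupp f) \sum_(q <- msupp g) path_mul1 (f@_p * g@_q) p q.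

Definition path_one : KQ := \sum_(v : vert Q) << qtriv v >>.

Lemma path_mul10 p q : path_mul1 0 p q = 0.
Proof. by rewrite /path_mul1; case: qcat => // r; rewrite monalgU0. Qed.

Lemma path_mul1D c d p q :
  path_mul1 (c + d) p q = path_mul1 c p q + path_mul1 d p q.
Proof. by rewrite /path_mul1; case: qcat => [r|]; rewrite ?monalgUD ?addr0. Qed.

Lemma path_mulw (d1 d2 : {fset qpath Q}) (f g : KQ) :
  (msupp f `<=` d1)%fset -> (msupp g `<=` d2)%fset ->
  path_mul f g = \sum_(p <- d1) \sum_(q <- d2) path_mul1 (f@_p * g@_q) p q.
Proof.
move=> le_d1 le_d2; rewrite /path_mul (big_fset_incl _ le_d1) /=.
  apply/eq_bigr=> p _; apply/big_fset_incl => // q _ /mcoeff_outdom ->.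
  by rewrite mulr0 path_mul10.
move=> p _ /mcoeff_outdom fp.
by rewrite big1 => // q _; rewrite fp mul0r path_mul10.
Qed.

Lemma path_mul0g : left_zero 0 path_mul.
Proof. by move=> g; rewrite /path_mul msupp0 big_seq_fset0. Qed.

Lemma path_mulg0 : right_zero 0 path_mul.
Proof.
by move=> g; rewrite /path_mul big1 // => p _; rewrite msupp0 big_seq_fset0.
Qed.

Lemma path_mulDl : left_distributive path_mul +%R.
Proof.
move=> f1 f2 g.
rewrite (path_mulw (msuppD_le f1 f2) (fsubset_refl _)).
rewrite (path_mulw (fsubsetUl _ (msupp f2)) (fsubset_refl (msupp g))).
rewrite (path_mulw (fsubsetUr (msupp f1) _) (fsubset_refl (msupp g))).
rewrite -big_split /=; apply/eq_bigr=> p _.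
rewrite -big_split /=; apply/eq_bigr=> q _.
by rewrite mcoeffD mulrDl path_mul1D.
Qed.

Lemma path_mulDr : right_distributive path_mul +%R.
Proof.
move=> f g1 g2.
rewrite (path_mulw (fsubset_refl _) (msuppD_le g1 g2)).
rewrite (path_mulw (fsubset_refl (msupp f)) (fsubsetUl _ (msupp g2))).
rewrite (path_mulw (fsubset_refl (msupp f)) (fsubsetUr (msupp g1) _)).
rewrite -big_split /=; apply/eq_bigr=> p _.
rewrite -big_split /=; apply/eq_bigr=> q _.
by rewrite mcoeffD mulrDr path_mul1D.
Qed.

Lemma path_mulUU c d p q :
  path_mul << c *g p >> << d *g q >> = path_mul1 (c * d) p q.
Proof.
by rewrite (path_mulw msuppU_le msuppU_le) !big_seq_fset1 !mcoeffUU.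
Qed.

Lemma path_mul_suml I (s : seq I) (F : I -> KQ) g :
  path_mul (\sum_(i <- s) F i) g = \sum_(i <- s) path_mul (F i) g.
Proof.
exact: (big_morph (path_mul^~ g) (fun _ _ => path_mulDl _ _ _) (path_mul0g _)).
Qed.

Lemma path_mul_sumr I (s : seq I) (F : I -> KQ) f :
  path_mul f (\sum_(i <- s) F i) = \sum_(i <- s) path_mul f (F i).
Proof.
exact: (big_morph (path_mul f) (fun _ _ => path_mulDr _ _ _) (path_mulg0 _)).
Qed.

Lemma path_mulA : associative path_mul.
Proof.
move=> f g h; rewrite [f]monalgE.
rewrite (path_mul_suml _ _ (path_mul g h)) (path_mul_suml _ _ g).
rewrite (path_mul_suml _ _ h); apply/eq_bigr => p _; set a := << _ *g _ >>.
rewrite [g]monalgE (path_mul_suml _ _ h) 2!(path_mul_sumr _ _ a).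
rewrite (path_mul_suml _ _ h); apply/eq_bigr => q _; set b := << _ *g _ >>.
rewrite [h]monalgE (path_mul_sumr _ _ b) (path_mul_sumr _ _ a).
rewrite (path_mul_sumr _ _ (path_mul a b)); apply/eq_bigr => r _.
rewrite /a /b {a b}.
rewrite !path_mulUU /path_mul1; have := qcatA p q r.
case: (qcat q r) => [s|]; case: (qcat p q) => [t|] /= e.
- by rewrite !path_mulUU /path_mul1 e mulrA.
- by rewrite path_mulUU /path_mul1 e path_mul0g.
- by rewrite path_mulUU /path_mul1 -e path_mulg0.
- by rewrite path_mulg0 path_mul0g.
Qed.

Lemma path_mul1g : left_id path_one path_mul.
Proof.
move=> f; rewrite /path_one path_mul_suml [f]monalgE.
under eq_bigr do rewrite path_mul_sumr.
rewrite exchange_big /=; apply: eq_bigr => p _.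
rewrite (bigD1 (qsrc p)) //= path_mulUU /path_mul1 qcat1p eqxx mul1r.
rewrite big1 ?addr0 // => v nv.
by rewrite path_mulUU /path_mul1 qcat1p eq_sym (negbTE nv).
Qed.

Lemma path_mulg1 : right_id path_one path_mul.
Proof.
move=> f; rewrite /path_one path_mul_sumr [f]monalgE.
under eq_bigr do rewrite path_mul_suml.
rewrite exchange_big /=; apply: eq_bigr => p _.
rewrite (bigD1 (qtgt p)) //= path_mulUU /path_mul1 qcatp1 eqxx mulr1.
rewrite big1 ?addr0 // => v nv.
by rewrite path_mulUU /path_mul1 qcatp1 eq_sym (negbTE nv).
Qed.

HB.instance Definition _ := GRing.Zmodule_isPzRing.Build KQ
  path_mulA path_mul1g path_mulg1 path_mulDl path_mulDr.

End PathAlgebra.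

Record ideal (A : pzRingType) := Ideal {
  in_ideal :> A -> Prop;
  ideal0 : in_ideal 0;
  idealD : forall x y, in_ideal x -> in_ideal y -> in_ideal (x + y);
  idealMl : forall a x, in_ideal x -> in_ideal (a * x);
  idealMr : forall a x, in_ideal x -> in_ideal (x * a) }.

Section Ideals.
Variable A : pzRingType.

Definition right_ideal (I : A -> Prop) : Prop :=
  [/\ I 0, forall x y, I x -> I y -> I (x + y) & forall x a, I x -> I (x * a)].

Definition maximal_right_ideal (I : A -> Prop) : Prop :=
  [/\ right_ideal I, ~ I 1 &
      forall J : A -> Prop, right_ideal J -> (forall x, I x -> J x) -> ~ J 1 ->
        forall x, J x -> I x].

(* The Jacobson radical: the intersection of all maximal right ideals. *)
Definition in_rad (x : A) : Prop :=
  forall I : A -> Prop, maximal_right_ideal I -> I x.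

Lemma in_rad0 : in_rad 0.
Proof. by move=> I [[]]. Qed.

Lemma in_radD x y : in_rad x -> in_rad y -> in_rad (x + y).
Proof. by move=> rx ry I mI; case: (mI) => -[_ ID _] _ _; apply: ID; [apply: rx | apply: ry]. Qed.

Lemma in_radMr a x : in_rad x -> in_rad (x * a).
Proof. by move=> rx I mI; case: (mI) => -[_ _ IM] _ _; apply: IM; apply: rx. Qed.

Lemma in_radMl a x : in_rad x -> in_rad (a * x).
Proof.
move=> rx I mI; case: (mI) => -[I0 ID IM] I1 Imax.
have [Ia|nIa] := pselect (I a); first exact: IM.
apply: (rx (fun y => I (a * y))); split; last 1 first.
- move=> J [J0 JD JM] IJ nJ1 y Jy; apply: contrapT => nIay.
  pose J' z := exists u b, I u /\ z = u + a * y * b.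
  have [u [b [Iu e]]] : J' a.
    have [|nJ'a] := pselect (J' a); first by [].
    have J'r : right_ideal J'.
      split.
      - by exists 0, 0; rewrite mulr0 addr0.
      - move=> _ _ [u [b [Iu ->]]] [v [c [Iv ->]]].
        by exists (u + v), (b + c); rewrite mulrDr addrACA; split; first exact: ID.
      - move=> _ c [u [b [Iu ->]]].
        by exists (u * c), (b * c); rewrite mulrDl !mulrA; split; first exact: IM.
    case: nIay; apply: (Imax J') => //.
    - by move=> z Iz; exists z, 0; rewrite mulr0 addr0.
    - move=> J'1; apply: nJ'a; rewrite -[a]mul1r.
      by case: J'r => _ _; apply.
    - by exists 0, 1; rewrite add0r mulr1.
  apply: nJ1; rewrite -(subrK (y * b) 1); apply: JD; last exact: JM.
  by apply: IJ; rewrite mulrBr mulr1 mulrA {1}e addrK.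
- split=> [|u v Iu Iv|u b Iu]; first by rewrite mulr0.
  + by rewrite mulrDr; apply: ID.
  + by rewrite mulrA; apply: IM.
- by rewrite mulr1.
Qed.

Definition jacobson_rad : ideal A := Ideal in_rad0 in_radD in_radMl in_radMr.

Section Product.
Variables I J : ideal A.

Definition in_ideal_mul (x : A) : Prop :=
  exists k (a b : 'I_k -> A),
    [/\ forall i, I (a i), forall i, J (b i) & x = \sum_(i < k) a i * b i].

Lemma in_ideal_mul0 : in_ideal_mul 0.
Proof. by exists 0%N, (fun=> 0), (fun=> 0); rewrite big_ord0; split=> // -[]. Qed.

Lemma in_ideal_mulD x y :
  in_ideal_mul x -> in_ideal_mul y -> in_ideal_mul (x + y).
Proof.
move=> [k [a [b [Ia Jb ->]]]] [k' [a' [b' [Ia' Jb' ->]]]].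
exists (k + k')%N, (fun i => match split i with inl j => a j | inr j => a' j end),
  (fun i => match split i with inl j => b j | inr j => b' j end).
split=> [i|i|]; try by case: split.
by rewrite big_split_ord /=; congr (_ + _); apply: eq_bigr => i _;
  rewrite ?(unsplitK (inl i)) ?(unsplitK (inr i)).
Qed.

Lemma in_ideal_mulMl c x : in_ideal_mul x -> in_ideal_mul (c * x).
Proof.
move=> [k [a [b [Ia Jb ->]]]]; exists k, (fun i => c * a i), b.
split=> // [i|]; first exact: idealMl.
by rewrite mulr_sumr; apply: eq_bigr => i _; rewrite mulrA.
Qed.

Lemma in_ideal_mulMr c x : in_ideal_mul x -> in_ideal_mul (x * c).
Proof.
move=> [k [a [b [Ia Jb ->]]]]; exists k, a, (fun i => b i * c).
split=> // [i|]; first exact: idealMr.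
by rewrite mulr_suml; apply: eq_bigr => i _; rewrite mulrA.
Qed.

Definition ideal_mul : ideal A :=
  Ideal in_ideal_mul0 in_ideal_mulD in_ideal_mulMl in_ideal_mulMr.

End Product.

(* The unit ideal, serving as the 0th power. *)
Definition ideal_full : ideal A :=
  @Ideal A (fun=> True) I (fun _ _ _ _ => I) (fun _ _ _ => I) (fun _ _ _ => I).

Definition ideal_exp (I : ideal A) (l : nat) : ideal A :=
  iter l (ideal_mul I) ideal_full.

End Ideals.

Section QuotientRing.
Variables (A : pzRingType) (I : ideal A).

Definition ideal_pred : {pred A} := fun x => `[< I x >].

Lemma ideal_predP x : reflect (I x) (x \in ideal_pred).
Proof. exact: asboolP. Qed.

Lemma ideal_pred_zmod : zmod_closed ideal_pred.
Proof.
split=> [|x y /ideal_predP Ix /ideal_predP Iy]; apply/ideal_predP.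
  exact: ideal0.
by apply: idealD => //; rewrite -mulN1r; apply: idealMl.
Qed.

HB.instance Definition _ := GRing.isZmodClosed.Build A ideal_pred ideal_pred_zmod.

Definition quot_ring : Type := Quotient.quot ideal_pred.

HB.instance Definition _ := GRing.Zmodule.on quot_ring.
HB.instance Definition _ := ZmodQuotient.on quot_ring.

Local Open Scope quotient_scope.

Definition quot_proj : A -> quot_ring := \pi_quot_ring.

Definition quot_one : quot_ring := quot_proj 1.
Definition quot_mul (x y : quot_ring) : quot_ring :=
  quot_proj (repr x * repr y).

Lemma quot_projP x y : quot_proj x = quot_proj y <-> I (x - y).
Proof.
split=> [e|Ixy].
  by apply/ideal_predP; rewrite Quotient.idealrBE; apply/eqP.
by apply/eqP; rewrite -Quotient.idealrBE; apply/ideal_predP.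
Qed.

Lemma quot_projM x y : quot_proj (x * y) = quot_mul (quot_proj x) (quot_proj y).
Proof.
rewrite /quot_mul; set x' := repr _; set y' := repr _.
have Ix : I (x - x') by apply/quot_projP; rewrite /quot_proj reprK.
have Iy : I (y - y') by apply/quot_projP; rewrite /quot_proj reprK.
apply/quot_projP; rewrite -(subrK (x' * y) (x * y)) -addrA -mulrBl -mulrBr.
by apply: idealD; [apply: idealMr | apply: idealMl].
Qed.

Lemma quot_projD x y : quot_proj (x + y) = quot_proj x + quot_proj y.
Proof. exact: (raddfD (\pi_quot_ring)). Qed.

Lemma quot_ringW (P : quot_ring -> Prop) :
  (forall x, P (quot_proj x)) -> forall x, P x.
Proof. by move=> h x; rewrite -[x]reprK; apply: h. Qed.

Lemma quot_mulA : associative quot_mul.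
Proof.
elim/quot_ringW=> x; elim/quot_ringW=> y; elim/quot_ringW=> z.
by rewrite -!quot_projM mulrA.
Qed.

Lemma quot_mul1x : left_id quot_one quot_mul.
Proof. by elim/quot_ringW=> x; rewrite -quot_projM mul1r. Qed.

Lemma quot_mulx1 : right_id quot_one quot_mul.
Proof. by elim/quot_ringW=> x; rewrite -quot_projM mulr1. Qed.

Lemma quot_mulDl : left_distributive quot_mul +%R.
Proof.
elim/quot_ringW=> x; elim/quot_ringW=> y; elim/quot_ringW=> z.
by rewrite -!(quot_projD, quot_projM) mulrDl.
Qed.

Lemma quot_mulDr : right_distributive quot_mul +%R.
Proof.
elim/quot_ringW=> x; elim/quot_ringW=> y; elim/quot_ringW=> z.
by rewrite -!(quot_projD, quot_projM) mulrDr.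
Qed.

HB.instance Definition _ := GRing.Zmodule_isPzRing.Build quot_ring
  quot_mulA quot_mul1x quot_mulx1 quot_mulDl quot_mulDr.

End QuotientRing.

(* A right module over [A] is a left module over the converse ring. *)
Definition rmodType (A : pzRingType) := lmodType A^c.

Section Modules.
Variable A : pzRingType.
Implicit Types M N X Y Z : rmodType A.

(* Membership in mod A. *)
Definition fin_gen M : Prop :=
  exists k (g : 'I_k -> M), forall x, exists c : 'I_k -> A^c,
    x = \sum_(i < k) c i *: g i.

Definition isomorphic M N : Prop := exists f : {linear M -> N}, bijective f.

Definition surjective (U V : Type) (f : U -> V) : Prop :=
  forall y, exists x, f x = y.

Definition projective (P : rmodType A) : Prop :=
  forall X Y (g : {linear X -> Y}) (f : {linear P -> Y}), surjective g ->
    exists h : {linear P -> X}, forall x, g (h x) = f x.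

Record proj_resolution M := ProjResolution {
  res_obj :> nat -> rmodType A;
  res_diff : forall i, {linear res_obj i.+1 -> res_obj i};
  res_aug : {linear res_obj 0%N -> M};
  res_proj : forall i, projective (res_obj i);
  res_aug_surj : surjective res_aug;
  res_exact0 : forall x, res_aug x = 0 <-> exists y, res_diff 0%N y = x;
  res_exact : forall i x,
    res_diff i x = 0 <-> exists y, res_diff i.+1 y = x }.

(* The complex Hom(P_0, N) -> Hom(P_1, N) -> Hom(P_2, N) -> ... obtained from a
   resolution P of M has zero cohomology in degree [i]. *)
Definition cocycle M N (P : proj_resolution M) i (f : {linear P i -> N}) : Prop :=
  forall x, f (res_diff P i x) = 0.

Definition coboundary M N (P : proj_resolution M) i :
    {linear P i -> N} -> Prop :=
  match i with
  | 0%N => fun f => forall x, f x = 0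
  | j.+1 => fun f =>
      exists g : {linear P j -> N}, forall x, f x = g (res_diff P j x)
  end.

(* Ext^i(M, N) = 0. As Ext^i(M, N) is independent of the resolution up to
   isomorphism, its vanishing may be required on all of them. *)
Definition Ext_zero i M N : Prop :=
  forall (P : proj_resolution M) (f : {linear P i -> N}),
    cocycle f -> coboundary f.

Definition pdim_le M (d : nat) : Prop :=
  exists P : proj_resolution M, forall i, (d < i)%N -> forall x : P i, x = 0.

Definition gldim_le (d : nat) : Prop := forall M, fin_gen M -> pdim_le M d.

(* n <= gl.dim A, where gl.dim A is a natural number or infinity. *)
Definition le_gldim (n : nat) : Prop := forall d, gldim_le d -> (n <= d)%N.

(* A full subcategory of mod A is given by its class of objects. *)
Section Subcategory.
Variable C : rmodType A -> Prop.

Definition left_approximation M X (f : {linear M -> X}) : Prop :=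
  C X /\ forall X' (g : {linear M -> X'}), C X' ->
    exists h : {linear X -> X'}, forall x, h (f x) = g x.

Definition right_approximation M X (f : {linear X -> M}) : Prop :=
  C X /\ forall X' (g : {linear X' -> M}), C X' ->
    exists h : {linear X' -> X}, forall x, f (h x) = g x.

Definition functorially_finite : Prop :=
  forall M, fin_gen M ->
    (exists X (f : {linear M -> X}), left_approximation f) /\
    (exists X (f : {linear X -> M}), right_approximation f).

(* Closure under summands includes closure under isomorphism (take Y = 0). *)
Record cluster_tilting (n : nat) : Prop := ClusterTilting {
  ct_fin_gen : forall X, C X -> fin_gen X;
  ct_sum : forall X Y, C X -> C Y -> C (X * Y)%type;
  ct_summand : forall X Y Z, C Z -> isomorphic (X * Y)%type Z -> C X;
  ct_functorially_finite : functorially_finite;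
  ct_right : forall X, C X <-> fin_gen X /\
    forall i Y, (0 < i < n)%N -> C Y -> Ext_zero i Y X;
  ct_left : forall X, C X <-> fin_gen X /\
    forall i Y, (0 < i < n)%N -> C Y -> Ext_zero i X Y }.

End Subcategory.

Definition admits_cluster_tilting (n : nat) : Prop :=
  exists C : rmodType A -> Prop, cluster_tilting C n.

End Modules.

(* Vertex k of the linear quiver m -> m-1 -> ... -> 1 is the ordinal k-1, and
   the arrow a_k : k+1 -> k is the ordinal k-1 of 'I_m.-1. *)
Lemma linear_src_subproof m (a : 'I_m.-1) : (a.+1 < m)%N.
Proof. by rewrite -ltn_predRL. Qed.

Definition linear_quiver (m : nat) : quiver :=
  @Quiver 'I_m 'I_m.-1 (fun a => Ordinal (linear_src_subproof a))
    (widen_ord (leq_pred m)).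

(* Only the ring structure of the quotient matters for its module category, so
   the scalar action of K is not recorded. *)
Definition Lambda (K : fieldType) (m l : nat) : pzRingType :=
  quot_ring (ideal_exp (jacobson_rad (path_alg K (linear_quiver m))) l).

(* Main.v *)
(* A module over [Lambda K m l] is a graded module with a nilpotent operator
   (all arrows at once) of degree -1, and every finitely generated one is a
   direct sum of interval modules: a homogeneous generating family whose total
   length is minimal is independent. Interval modules have explicit minimal
   projective resolutions by interval modules, so Ext^i between two of them is
   nonzero exactly when their endpoints interlace with a shift by a multiple of
   [l]. Since Ext is additive and approximations can be built summandwise, an
   n-cluster tilting subcategory is the same as a set of intervals that is
   maximal rigid on both sides for this combinatorial relation. Such a set
   contains the projective and the injective intervals and is stable under the
   n-Auslander-Reiten translation, which decreases endpoints; following the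
   injective intervals of lengths 1 and 2 down to a projective one forces the
   arithmetic conditions. Conversely, under these conditions the translation
   orbits of the injective intervals form such a set. *)

(* Origin of the constants. Write (b, a) for the interval module living in the degrees p with b < p
   <= a. For n = 2j the n-Auslander-Reiten translation sends (b, a) to (a - jl - 1, b + l - jl - 1):
   it exchanges the roles of the two ends, and two steps lower both by 2jl - l + 2 = nl - l + 2, the
   period in (ii). For n = 2j + 1 every step lowers both ends by jl + 1. Lengths stay strictly
   between 0 and l, so an orbit can stop only at a projective (0, x). The injective intervals of
   lengths 1 and 2 have the consecutive lower ends m - 1 and m - 2, and no period greater than 1
   divides both. There are two ways out. For even n an orbit may stop after an odd number of steps;
   this constrains the common upper end m and gives (ii). For l = 2 the interval of length 2 is
   itself projective and starts no orbit, and the one of length 1 leaves (i). *)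
Require Import Defs.
From HB Require Import structures.
From mathcomp Require Import all_boot all_algebra.
From mathcomp Require Import finmap boolp monalg zify.

Set Implicit Arguments.
Unset Strict Implicit.
Unset Printing Implicit Defensive.

Import GRing.Theory.

(** * Ext and projective resolutions *)

Section Pullback.
Local Open Scope ring_scope.
Variables (A : pzRingType) (X Y P : rmodType A).
Variables (g : {linear X -> Y}) (f : {linear P -> Y}).

Definition pullback_pred : {pred P * X} := fun z => f z.1 == g z.2.

Lemma pullback_submod : submod_closed pullback_pred.
Proof.
split; first by rewrite unfold_in /= !linear0.
by move=> a u v; rewrite !unfold_in /= => /eqP eu /eqP ev; rewrite !linearP eu ev.
Qed.

HB.instance Definition _ :=
  GRing.isSubmodClosed.Build A^c (P * X)%type pullback_pred pullback_submod.

Record pullback := Pullback { pb_val : P * X; _ : pb_val \in pullback_pred }.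
HB.instance Definition _ := [isSub for pb_val].
HB.instance Definition _ := [Choice of pullback by <:].
HB.instance Definition _ := [SubChoice_isSubLmodule of pullback by <:].

Definition pb_fst (z : pullback) : P := (val z).1.
Definition pb_snd (z : pullback) : X := (val z).2.
Lemma pb_fst_linear : linear pb_fst. Proof. by move=> a u v; rewrite /pb_fst linearP. Qed.
Lemma pb_snd_linear : linear pb_snd. Proof. by move=> a u v; rewrite /pb_snd linearP. Qed.
HB.instance Definition _ := GRing.isLinear.Build A^c pullback P _ pb_fst pb_fst_linear.
HB.instance Definition _ := GRing.isLinear.Build A^c pullback X _ pb_snd pb_snd_linear.

(** Projectivity speaks of surjective maps, while [g] only has to reach the image of [f]. The
    pullback of [g] along [f] does map onto [P]; a section of it followed by the projection to [X]
    is the lift. *)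
Lemma projective_lift : projective P -> (forall p, exists x, g x = f p) ->
  exists h : {linear P -> X}, forall p, g (h p) = f p.
Proof.
move=> Pproj im.
have fst_surj : surjective pb_fst.
  move=> p; have [x e] := im p.
  have px : (p, x) \in pullback_pred by rewrite unfold_in /= e.
  by exists (Pullback px).
have [h hK] := Pproj _ _ pb_fst (idfun : {linear P -> P}) fst_surj.
exists (pb_snd \o h : {linear P -> X}) => p /=.
by have := valP (h p); rewrite unfold_in => /eqP <-; congr (f _); apply: hK.
Qed.

End Pullback.
Arguments projective_lift {A X Y P} g f _ _.

Section Resolutions.
Local Open Scope ring_scope.
Variable A : pzRingType.
Implicit Types M N X Y : rmodType A.

Lemma res_diffK M (P : proj_resolution M) i x :
  res_diff P i (res_diff P i.+1 x) = 0.
Proof. by apply/res_exact; exists x. Qed.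

(* [h0] and [h1] are a chain homotopy from [v \o u] to the identity; only two
   consecutive degrees are recorded, which is all that the induction needs. *)
Lemma comparison M (P P' : proj_resolution M) i :
  exists (u0 : {linear P i -> P' i}) (v0 : {linear P' i -> P i})
    (u1 : {linear P i.+1 -> P' i.+1}) (v1 : {linear P' i.+1 -> P i.+1})
    (h0 : {linear P i -> P i.+1}) (h1 : {linear P i.+1 -> P i.+2}),
  [/\ forall x, res_diff P' i (u1 x) = u0 (res_diff P i x),
      forall x, res_diff P i (v1 x) = v0 (res_diff P' i x) &
      forall x, v1 (u1 x) - x = res_diff P i.+1 (h1 x) + h0 (res_diff P i x)].
Proof.
elim: i => [|i [u0 [v0 [u1 [v1 [h0 [h1 [du dv hE]]]]]]]].
  have [u0 u0E] := projective_lift (res_aug P') (res_aug P)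
      (@res_proj _ _ P 0) (fun p => @res_aug_surj _ _ P' _).
  have [v0 v0E] := projective_lift (res_aug P) (res_aug P')
      (@res_proj _ _ P' 0) (fun p => @res_aug_surj _ _ P _).
  have [|u1 u1E] := projective_lift (res_diff P' 0)
      (u0 \o res_diff P 0 : {linear _ -> _}) (@res_proj _ _ P 1).
    move=> p; apply/res_exact0; rewrite /= u0E.
    by apply/res_exact0; exists p.
  have [|v1 v1E] := projective_lift (res_diff P 0)
      (v0 \o res_diff P' 0 : {linear _ -> _}) (@res_proj _ _ P' 1).
    move=> p; apply/res_exact0; rewrite /= v0E.
    by apply/res_exact0; exists p.
  have [|h0 h0E] := projective_lift (res_diff P 0)
      ((v0 \o u0) \- idfun : {linear _ -> _}) (@res_proj _ _ P 0).
    by move=> p; apply/res_exact0; rewrite /= linearB /= v0E u0E subrr.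
  have [|h1 h1E] := projective_lift (res_diff P 1)
      (((v1 \o u1) \- idfun) \- (h0 \o res_diff P 0) : {linear _ -> _}) (@res_proj _ _ P 1).
    move=> p; apply/res_exact; rewrite /= !linearB /= v1E /= u1E h0E /=.
    by rewrite subrr.
  exists u0, v0, u1, v1, h0, h1; split=> // x.
  by rewrite h1E /= subrK.
have [|u2 u2E] := projective_lift (res_diff P' i.+1)
    (u1 \o res_diff P i.+1 : {linear _ -> _}) (@res_proj _ _ P i.+2).
  by move=> p; apply/res_exact; rewrite /= du res_diffK linear0.
have [|v2 v2E] := projective_lift (res_diff P i.+1)
    (v1 \o res_diff P' i.+1 : {linear _ -> _}) (@res_proj _ _ P' i.+2).
  by move=> p; apply/res_exact; rewrite /= dv res_diffK linear0.
have [|h2 h2E] := projective_lift (res_diff P i.+2)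
    (((v2 \o u2) \- idfun) \- (h1 \o res_diff P i.+1) : {linear _ -> _})
    (@res_proj _ _ P i.+2).
  move=> p; apply/res_exact; rewrite /= !linearB /= v2E /= u2E /=.
  by rewrite hE res_diffK linear0 addr0 subrr.
exists u1, v1, u2, v2, h1, h2; split=> // x.
by rewrite h2E /= subrK.
Qed.

Definition Ext_zero_on M N (P : proj_resolution M) i :=
  forall f : {linear P i -> N}, cocycle f -> coboundary f.

Lemma Ext_zero_on_indep M N (P P' : proj_resolution M) i :
  Ext_zero_on N P' i.+1 -> Ext_zero_on N P i.+1.
Proof.
move=> Z' f fc; have [u0 [v0 [u1 [v1 [h0 [h1 [du dv hE]]]]]]] := comparison P P' i.
have [x|g gE] := Z' (f \o v1 : {linear _ -> _}).
  have : res_diff P i (v1 (res_diff P' i.+1 x)) = 0 by rewrite dv res_diffK linear0.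
  by move=> /res_exact [y] /= <-; apply: fc.
(* Since [f] vanishes on boundaries, the homotopy gives [f] as [f \o v1 \o u1] minus [f \o h0 \o d].
   The first term factors through [d] because [f \o v1] is a coboundary on [P'] and [u] commutes
   with the differentials. *)
exists ((g \o u0) \- (f \o h0) : {linear _ -> _}) => x /=.
have := congr1 f (hE x); rewrite linearB linearD fc add0r /= => <-.
by rewrite -du -gE /= opprB addrC subrK.
Qed.

Lemma Ext_zeroP M N (P : proj_resolution M) i :
  Ext_zero i.+1 M N <-> Ext_zero_on N P i.+1.
Proof. by split=> [Z|Z P']; [apply: Z | apply: Ext_zero_on_indep Z]. Qed.

Definition transport_resolution M M' (u : {linear M -> M'}) (v : M' -> M)
    (uK : cancel u v) (vK : cancel v u) (P : proj_resolution M) : proj_resolution M'.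
Proof.
refine (@ProjResolution _ M' P (res_diff P) (u \o res_aug P : {linear _ -> _})
  (@res_proj _ _ P) _ _ (@res_exact _ _ P)).
- move=> y; have [x e] := @res_aug_surj _ _ P (v y).
  by exists x; rewrite /= e vK.
- move=> x; rewrite -res_exact0 /=; split=> [e|->]; last exact: linear0.
  by rewrite -[LHS]uK e -[X in v X](linear0 u) uK.
Defined.

Lemma isomorphic_inv X Y (u : {linear X -> Y}) : bijective u ->
  exists v : {linear Y -> X}, cancel u v /\ cancel v u.
Proof.
move=> [v uK vK].
have v_lin : linear v.
  by move=> a x y; apply: (can_inj uK); rewrite linearP /= !vK.
by exists (HB.pack v (GRing.isLinear.Build A^c Y X *:%R v v_lin) : {linear Y -> X}).
Qed.

Lemma Ext_zero_iso M M' N i : isomorphic M M' ->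
  Ext_zero i.+1 M N -> Ext_zero i.+1 M' N.
Proof.
move=> [u /isomorphic_inv[v [uK vK]]] Z P'.
by have := Z (transport_resolution vK uK P'); apply.
Qed.

Section ProdResolution.
Variables (M M' : rmodType A) (P : proj_resolution M) (P' : proj_resolution M').

Definition pair_fun (X Y X' Y' : rmodType A) (f : {linear X -> Y})
  (f' : {linear X' -> Y'}) (z : X * X') : Y * Y' := (f z.1, f' z.2).

Lemma pair_fun_linear (X Y X' Y' : rmodType A) (f : {linear X -> Y})
  (f' : {linear X' -> Y'}) : linear (pair_fun f f').
Proof. by move=> a u v; rewrite /pair_fun !linearP. Qed.

HB.instance Definition _ (X Y X' Y' : rmodType A) (f : {linear X -> Y})
    (f' : {linear X' -> Y'}) :=
  GRing.isLinear.Build A^c (X * X')%type (Y * Y')%type _ (pair_fun f f')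
    (pair_fun_linear f f').

Definition inl_fun (X Y : rmodType A) (x : X) : X * Y := (x, 0).
Definition inr_fun (X Y : rmodType A) (y : Y) : X * Y := (0, y).
Lemma inl_fun_linear (X Y : rmodType A) : linear (@inl_fun X Y).
Proof. by move=> a u v; congr pair; rewrite /= scaler0 addr0. Qed.
Lemma inr_fun_linear (X Y : rmodType A) : linear (@inr_fun X Y).
Proof. by move=> a u v; congr pair; rewrite /= scaler0 addr0. Qed.
HB.instance Definition _ (X Y : rmodType A) :=
  GRing.isLinear.Build A^c X (X * Y)%type _ (@inl_fun X Y) (@inl_fun_linear X Y).
HB.instance Definition _ (X Y : rmodType A) :=
  GRing.isLinear.Build A^c Y (X * Y)%type _ (@inr_fun X Y) (@inr_fun_linear X Y).

Lemma inl_inrE (X Y : rmodType A) (x : X) (y : Y) :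
  inl_fun Y x + inr_fun X y = (x, y).
Proof. by congr pair; rewrite /= ?addr0 ?add0r. Qed.

Lemma pairE (X Y : rmodType A) (z : X * Y) :
  z = inl_fun Y z.1 + inr_fun X z.2.
Proof. by case: z => x y; congr pair; rewrite /= ?addr0 ?add0r. Qed.

Lemma projective_prod (X Y : rmodType A) :
  projective X -> projective Y -> projective (X * Y)%type.
Proof.
move=> pX pY U V g f gs.
have [h hE] := pX _ _ g (f \o @inl_fun X Y : {linear _ -> _}) gs.
have [k kE] := pY _ _ g (f \o @inr_fun X Y : {linear _ -> _}) gs.
exists ((h \o fst) \+ (k \o snd) : {linear _ -> _}) => z.
by rewrite [in RHS](pairE z) /= !linearD /= hE kE.
Qed.

Lemma pair_fun_exact (X1 X2 X3 Y1 Y2 Y3 : rmodType A)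
    (f : {linear X2 -> X3}) (g : {linear X1 -> X2})
    (f' : {linear Y2 -> Y3}) (g' : {linear Y1 -> Y2}) :
  (forall x, f x = 0 <-> exists y, g y = x) ->
  (forall x, f' x = 0 <-> exists y, g' y = x) ->
  forall x, pair_fun f f' x = 0 <-> exists y, pair_fun g g' y = x.
Proof.
move=> e e' [x x']; split=> [[/e [y <-] /e' [y' <-]]|[[y y'] [<- <-]]].
  by exists (y, y').
congr pair; [apply/e | apply/e'] => /=; by [exists y | exists y'].
Qed.

Definition prod_resolution : proj_resolution (M * M')%type.
Proof.
refine (@ProjResolution _ (M * M')%type (fun i => (P i * P' i)%type)
   (fun i => pair_fun (res_diff P i) (res_diff P' i) : {linear _ -> _})
   (pair_fun (res_aug P) (res_aug P')) _ _ _ _).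
- by move=> i; apply: projective_prod; apply: res_proj.
- move=> [y y']; have [x <-] := @res_aug_surj _ _ P y.
  by have [x' <-] := @res_aug_surj _ _ P' y'; exists (x, x').
- by apply: pair_fun_exact; apply: res_exact0.
- by move=> i; apply: pair_fun_exact; apply: res_exact.
Defined.

Lemma Ext_zero_prod N i :
  Ext_zero i.+1 (M * M')%type N <-> Ext_zero i.+1 M N /\ Ext_zero i.+1 M' N.
Proof.
rewrite (Ext_zeroP N prod_resolution) (Ext_zeroP N P) (Ext_zeroP N P').
split=> [Z|[Z Z'] f fc].
  split=> f fc.
    have [|g gE] := Z (f \o fst : {linear _ -> _}); first by move=> x; apply: fc.
    exists (g \o @inl_fun _ _ : {linear _ -> _}) => x.
    by rewrite [LHS](gE (x, 0)) /= /pair_fun /= linear0.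
  have [|g gE] := Z (f \o snd : {linear _ -> _}); first by move=> x; apply: fc.
  exists (g \o @inr_fun _ _ : {linear _ -> _}) => x.
  by rewrite [LHS](gE (0, x)) /= /pair_fun /= linear0.
have [x|g gE] := Z (f \o @inl_fun _ _ : {linear _ -> _}).
  by rewrite -[RHS](fc (x, 0)) /= /pair_fun /= linear0.
have [x|g' gE'] := Z' (f \o @inr_fun _ _ : {linear _ -> _}).
  by rewrite -[RHS](fc (0, x)) /= /pair_fun /= linear0.
exists ((g \o fst) \+ (g' \o snd) : {linear _ -> _}) => z.
by rewrite [in LHS](pairE z) linearD /= -gE -gE'.
Qed.

End ProdResolution.
End Resolutions.

(** * The path algebra as lower triangular matrices *)

Section PathMatrix.
Local Open Scope ring_scope.
Variables (K : fieldType) (m : nat).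
Local Notation Q := (linear_quiver m).
Local Notation KQ := (path_alg K Q).

(** Two vertices of the linear quiver are joined by at most one path, so each coefficient of [f]
    gets a matrix entry of its own, and questions about the radical become questions about
    diagonals. *)
Definition path_mx (f : KQ) : 'M[K]_m :=
  \sum_(p <- msupp f) f@_p *: delta_mx (qsrc p : 'I_m) (qtgt p : 'I_m).

Lemma path_mxw (d : {fset qpath Q}) (f : KQ) : (msupp f `<=` d)%fset ->
  path_mx f = \sum_(p <- d) f@_p *: delta_mx (qsrc p : 'I_m) (qtgt p : 'I_m).
Proof.
move=> le_d; rewrite /path_mx (big_fset_incl _ le_d) //= => p _ /mcoeff_outdom ->.
by rewrite scale0r.
Qed.

Lemma path_mx_additive : zmod_morphism path_mx.
Proof.
move=> f g.
have le1 : (msupp (f - g) `<=` msupp f `|` msupp g)%fset by exact: msuppB_le.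
rewrite (path_mxw le1) (path_mxw (fsubsetUl (msupp f) (msupp g))).
rewrite (path_mxw (fsubsetUr (msupp f) (msupp g))) -sumrB.
by apply: eq_bigr => p _; rewrite mcoeffB scalerBl.
Qed.
HB.instance Definition _ :=
  GRing.isZmodMorphism.Build KQ 'M[K]_m path_mx path_mx_additive.

Lemma path_mxU c p :
  path_mx << c *g p >> = c *: delta_mx (qsrc p : 'I_m) (qtgt p : 'I_m).
Proof. by rewrite (path_mxw msuppU_le) big_seq_fset1 mcoeffUU. Qed.

Lemma path_mxM (f g : KQ) : path_mx (f * g) = path_mx f *m path_mx g.
Proof.
rewrite [f * g]/(path_mul f g) /path_mul raddf_sum /= [path_mx f]/path_mx mulmx_suml.
apply: eq_bigr => p _; rewrite raddf_sum /= [path_mx g]/path_mx mulmx_sumr.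
apply: eq_bigr => q _; rewrite -scalemxAl -scalemxAr mul_delta_mx_cond scalerA.
have [e|ne] := eqVneq (qtgt p) (qsrc q).
  have [r rE [r1 _ r2]] := qcatP e.
  by rewrite /path_mul1 rE path_mxU r1 r2 mulr1n.
by rewrite /path_mul1 qcatN // mulr0n scaler0 raddf0.
Qed.

Lemma path_mx1 : path_mx 1 = 1%:M.
Proof.
rewrite [1]/(path_one K Q) /path_one raddf_sum /=.
rewrite (eq_bigr (fun v : 'I_m => delta_mx v v)); last first.
  by move=> v _; rewrite path_mxU scale1r.
apply/matrixP => i j; rewrite summxE (bigD1 i) //= !mxE eqxx big1 ?addr0 /=.
  by rewrite eq_sym.
by move=> k nk; rewrite !mxE eq_sym (negbTE nk).
Qed.

Lemma walk_linear (v : 'I_m) (s : seq 'I_m.-1) : walk (v : vert Q) (s : seq (arr Q)) ->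
  (size s <= v /\ walk_end (v : vert Q) (s : seq (arr Q)) = v - size s :> nat)%N.
Proof.
elim: s v => [|a s IH] v /=; first by rewrite subn0.
case/andP => /eqP <- /= /IH [] /=.
by move=> /= le ->; rewrite subSS.
Qed.

Lemma walk_inj (v : 'I_m) (s t : seq 'I_m.-1) :
  walk (v : vert Q) (s : seq (arr Q)) -> walk (v : vert Q) (t : seq (arr Q)) ->
  size s = size t -> s = t.
Proof.
elim: s t v => [|a s IH] [|b t] v //= /andP[/eqP ea ws] /andP[/eqP eb wt] [e].
have eab : a = b by apply: val_inj; move: (congr1 val ea) (congr1 val eb) => /= <- [].
by rewrite -eab in wt *; rewrite (IH t _ ws wt e).
Qed.

Lemma qpath_linear (p : qpath Q) :
  (size (qarrows p) <= (qsrc p : 'I_m) /\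
   (qtgt p : 'I_m) = (qsrc p : 'I_m) - size (qarrows p) :> nat)%N.
Proof. exact: walk_linear (qpath_walk p). Qed.

Lemma qpath_inj (p q : qpath Q) : qsrc p = qsrc q -> qtgt p = qtgt q -> p = q.
Proof.
move=> es et; apply: qpath_eq => //.
have [lp ep] := qpath_linear p; have [lq eq] := qpath_linear q.
apply: (@walk_inj (qsrc p)); first exact: (qpath_walk p).
  rewrite es; exact: (qpath_walk q).
move: ep; rewrite et eq -es => e.
by rewrite -(subKn lp) -e subKn // es.
Qed.

Lemma path_mxE (f : KQ) (p : qpath Q) : path_mx f (qsrc p) (qtgt p) = f@_p.
Proof.
rewrite /path_mx summxE.
have E (q : qpath Q) : (f@_q *: delta_mx (qsrc q : 'I_m) (qtgt q : 'I_m))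
    (qsrc p) (qtgt p) = if q == p then f@_p else 0.
  rewrite !mxE; have [->|nq] := eqVneq q p; first by rewrite !eqxx mulr1.
  case: eqP => e1; last by rewrite mulr0.
  case: eqP => e2; last by rewrite mulr0.
  by case/eqP: nq; apply: qpath_inj.
rewrite (eq_bigr _ (fun q _ => E q)) -big_mkcond /=.
have [pf|pf] := boolP (p \in msupp f).
  by rewrite -big_filter filter_pred1_uniq ?fset_uniq // big_seq1.
by rewrite (mcoeff_outdom pf) big1.
Qed.

Lemma path_mx_inj : injective path_mx.
Proof. by move=> f g e; apply/malgP => p; rewrite -!path_mxE e. Qed.

Lemma path_mx_trig (f : KQ) (i j : 'I_m) : (i < j)%N -> path_mx f i j = 0.
Proof.
move=> lt; rewrite /path_mx summxE big1 // => p _; rewrite !mxE.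
case: eqP => e1; last by rewrite mulr0.
case: eqP => e2; last by rewrite mulr0.
by move: lt; rewrite e1 e2; have [_ ->] := qpath_linear p; rewrite ltnNge leq_subr.
Qed.

(** The ideal generated by the arrows, seen as the strictly lower triangular matrices. It turns out
    to be the Jacobson radical. *)
Definition arrow_ideal (f : KQ) : Prop := forall v, path_mx f v v = 0.

Lemma path_mxM_diag (f g : KQ) v :
  path_mx (f * g) v v = path_mx f v v * path_mx g v v.
Proof.
rewrite path_mxM mxE (bigD1 v) //= big1 ?addr0 // => w nw.
case: (ltngtP v w) => [lt|lt|e]; first by rewrite path_mx_trig // mul0r.
  by rewrite (path_mx_trig g lt) mulr0.
by move: nw; rewrite -(inj_eq val_inj) /= e eqxx.
Qed.

(** Reading off the diagonal entry at [v] is multiplicative by triangularity, hence a ring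
    homomorphism onto the field [K], and its kernel is a maximal right ideal. *)
Lemma rad_sub_arrow_ideal (f : KQ) : in_rad f -> arrow_ideal f.
Proof.
move=> rf v; apply: (rf (fun f => path_mx f v v = 0)); split.
- split=> [|x y ex ey|x a ex]; first by rewrite raddf0 mxE.
    by rewrite raddfD mxE ex ey addr0.
  by rewrite path_mxM_diag ex mul0r.
- by rewrite path_mx1 !mxE eqxx => /eqP; rewrite oner_eq0.
move=> J [J0 JD JM] sub nJ1 x Jx; apply: contrapT => /eqP nx; apply: nJ1.
set c := path_mx x v v in nx.
set y : KQ := << c^-1 *g qtriv (v : vert Q) >>.
rewrite -(subrK (x * y) 1); apply: JD; last exact: JM.
apply: sub; rewrite raddfB /= path_mx1 mxE [X in _ + X]mxE path_mxM_diag path_mxU.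
by rewrite !mxE !eqxx mulr1 divff // subrr.
Qed.

(** For [B = path_mx f] this means that only paths of length at least [k] occur in [f]. *)
Definition deep (k : nat) (B : 'M[K]_m) : Prop :=
  forall i j : 'I_m, (i < j + k)%N -> B i j = 0.

Lemma deepM k k' B C : deep k B -> deep k' C -> deep (k + k') (B *m C).
Proof.
move=> dB dC i j lt; rewrite mxE big1 // => w _.
have [le|lw] := ltnP i (w + k); first by rewrite dB ?mul0r.
by rewrite dC ?mulr0 //; lia.
Qed.

Lemma arrow_ideal_deep (f : KQ) : arrow_ideal f <-> deep 1 (path_mx f).
Proof.
split=> [df i j|df v]; last by apply: df; rewrite addn1.
rewrite addn1 ltnS leq_eqVlt => /orP[/eqP e|]; last exact: path_mx_trig.
by rewrite (val_inj e : i = j).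
Qed.

(* If [f] lies outside a maximal right ideal [I], then [1 = u + f a] with [u] in
   [I] and [f a] nilpotent, so that [u] is a unit. *)
Lemma arrow_ideal_sub_rad (f : KQ) : arrow_ideal f -> in_rad f.
Proof.
move=> af I [[I0 ID IM] nI1 Imax]; apply: contrapT => nIf.
pose J z := exists u a, I u /\ z = u + f * a.
have Jr : right_ideal J.
  split.
  - by exists 0, 0; rewrite mulr0 addr0.
  - move=> _ _ [u [a [Iu ->]]] [v [b [Iv ->]]].
    by exists (u + v), (a + b); rewrite mulrDr addrACA; split; first exact: ID.
  - move=> _ c [u [a [Iu ->]]].
    by exists (u * c), (a * c); rewrite mulrDl mulrA; split; first exact: IM.
have [u [a [Iu e1]]] : J 1.
  apply: contrapT => nJ1; apply: nIf; apply: (Imax J) => //.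
    by move=> z Iz; exists z, 0; rewrite mulr0 addr0.
  by exists 0, 1; rewrite add0r mulr1.
have deep_exp k : deep k (path_mx ((f * a) ^+ k)).
  elim: k => [|k IH]; first by move=> i j; rewrite addn0; apply: path_mx_trig.
  rewrite exprS path_mxM -add1n; apply: deepM IH.
  by apply/arrow_ideal_deep => v; rewrite path_mxM_diag af mul0r.
have nil : (f * a) ^+ m = 0.
  apply: path_mx_inj; rewrite raddf0; apply/matrixP => i j; rewrite [RHS]mxE.
  by apply: deep_exp; rewrite (leq_trans (ltn_ord i)) // leq_addl.
apply: nI1; have -> : 1 = u * (\sum_(i < m) (f * a) ^+ i) :> KQ.
  apply: oppr_inj; rewrite -mulNr; have := subrX1 (f * a) m; rewrite nil sub0r => ->; congr (_ * _).
  by rewrite e1 opprD addrCA subrr addr0.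
exact: IM.
Qed.

Lemma rad_exp_deep k (f : KQ) :
  ideal_exp (jacobson_rad (path_alg K Q)) k f -> deep k (path_mx f).
Proof.
elim: k f => [|k IH] f; first by move=> _ i j; rewrite addn0; apply: path_mx_trig.
move=> [N [a [b [ra rb ->]]]] i j lt; rewrite raddf_sum summxE big1 // => w _ /=.
rewrite path_mxM; apply: (@deepM 1 k _ _ _ _ i j lt); last exact/IH/rb.
by apply/arrow_ideal_deep; apply: rad_sub_arrow_ideal; apply: ra.
Qed.

(** Two facts about the ideal power suffice. It contains [arrows ^+ l], so that [sh] is nilpotent on
    every module; and by [rad_exp_deep] it has no paths shorter than [l], so that it acts by zero on
    intervals of length at most [l]. *)
Lemma exp_rad_exp k (f : KQ) : arrow_ideal f ->
  ideal_exp (jacobson_rad (path_alg K Q)) k (f ^+ k).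
Proof.
move=> af; elim: k => [//|k IH].
exists 1%N, (fun=> f), (fun=> f ^+ k); split=> [_|_|]; last by rewrite big_ord1 exprS.
  exact: arrow_ideal_sub_rad.
exact: IH.
Qed.

End PathMatrix.

(** * Modules over the truncated path algebra as graded modules *)

Section Generators.
Local Open Scope ring_scope.
Variables (K : fieldType) (m l : nat).
Local Notation Q := (linear_quiver m).
Local Notation KQ := (path_alg K Q).
Local Notation L := (Lambda K m l).

Fact scalar_path_subproof (c : K) : {f : KQ | path_mx f = c%:M}.
Proof.
exists (\sum_(v : 'I_m) << c *g qtriv (v : vert Q) >>).
rewrite raddf_sum /= (eq_bigr (fun v : 'I_m => c *: delta_mx v v)); last first.
  by move=> v _; rewrite path_mxU.
apply/matrixP => i j; rewrite summxE (bigD1 i) //= !mxE eqxx big1 ?addr0 /=.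
  by rewrite eq_sym; case: eqP; rewrite ?mulr1 ?mulr0.
by move=> k nk; rewrite !mxE eq_sym (negbTE nk) mulr0.
Qed.
Definition scalar_path c : KQ := sval (scalar_path_subproof c).
Lemma scalar_path_mx c : path_mx (scalar_path c) = c%:M.
Proof. exact: svalP (scalar_path_subproof c). Qed.

(* The idempotent of the vertex [p - 1] of ['I_m]. Thus degree [p] means vertex
   [p - 1], and degree [0] is always zero, which turns the truncation of natural
   subtraction into the convention that projectives [P_p] with [p <= 0] vanish. *)
Fact idem_path_subproof p :
  {f : KQ | path_mx f = \matrix_(i, j) ((i == j) && (i.+1 == p))%:R}.
Proof.
exists (\sum_(v < m | v.+1 == p) << qtriv (v : vert Q) >>).
rewrite raddf_sum /= (eq_bigr (fun v : 'I_m => delta_mx v v)); last first.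
  by move=> v _; rewrite path_mxU scale1r.
apply/matrixP => i j; rewrite summxE [RHS]mxE big_mkcond (bigD1 i) //= big1 ?addr0 => [|k nk].
  by case: ifP => _; rewrite ?mxE ?eqxx ?andbT ?andbF // eq_sym.
by case: ifP => _ //; rewrite !mxE eq_sym (negbTE nk).
Qed.
Definition idem_path p : KQ := sval (idem_path_subproof p).
Lemma idem_path_mx p :
  path_mx (idem_path p) = \matrix_(i, j) ((i == j) && (i.+1 == p))%:R.
Proof. exact: svalP (idem_path_subproof p). Qed.

Lemma walk_arrow (a : arr Q) : walk (src a, [:: a]).1 (src a, [:: a]).2.
Proof. by rewrite /= eqxx. Qed.

Fact arrows_subproof : {f : KQ | path_mx f = \matrix_(i, j) (i == j.+1 :> nat)%:R}.
Proof.
exists (\sum_(a < m.-1) << QPath (walk_arrow (a : arr Q)) >>).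
rewrite raddf_sum /= (eq_bigr (fun a : 'I_m.-1 =>
  delta_mx (src (a : arr Q) : 'I_m) (tgt (a : arr Q)))); last first.
  by move=> v _; rewrite path_mxU scale1r.
apply/matrixP => i j; rewrite summxE [RHS]mxE.
case: eqP => e.
  have lt : (j < m.-1)%N by have := ltn_ord i; lia.
  rewrite (bigD1 (Ordinal lt)) //= big1 ?addr0 => [|k nk]; rewrite !mxE -!(inj_eq val_inj) /=.
    by rewrite e !eqxx.
  by move: nk; rewrite -(inj_eq val_inj) /= eq_sym => /negbTE ->; rewrite andbF.
rewrite big1 // => k _; rewrite !mxE -!(inj_eq val_inj) /=.
by case: eqP => // e1; case: eqP => // e2; case: e; rewrite e1 e2.
Qed.
Definition arrows : KQ := sval arrows_subproof.
Lemma arrows_mx : path_mx arrows = \matrix_(i, j) (i == j.+1 :> nat)%:R.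
Proof. exact: svalP arrows_subproof. Qed.

Lemma arrows_exp_mx k : path_mx (arrows ^+ k) = \matrix_(i, j) (i == (j + k)%N :> nat)%:R.
Proof.
elim: k => [|k IH].
  by rewrite expr0 path_mx1; apply/matrixP => i j; rewrite !mxE addn0.
rewrite exprS path_mxM IH arrows_mx; apply/matrixP => i j; rewrite !mxE.
case: eqP => e.
  have lt : (j + k < m)%N by have := ltn_ord i; lia.
  rewrite (bigD1 (Ordinal lt)) //= big1 ?addr0 => [|w nw]; rewrite !mxE /=.
    by rewrite e addnS !eqxx mulr1.
  by move: nw; rewrite -(inj_eq val_inj) /= => /negbTE ->; rewrite mulr0.
rewrite big1 // => w _; rewrite !mxE.
by case: eqP => e1; rewrite ?mul0r //; case: eqP => e2; rewrite ?mulr0 //; lia.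
Qed.

Lemma path_monomialE c (p : qpath Q) :
  << c *g p >> = scalar_path c * (idem_path (qsrc p : 'I_m).+1 * arrows ^+ size (qarrows p)).
Proof.
apply: path_mx_inj; rewrite path_mxU [RHS]path_mxM [X in _ = _ *m X]path_mxM.
rewrite scalar_path_mx idem_path_mx arrows_exp_mx.
rewrite mul_scalar_mx; congr (_ *: _).
apply/matrixP => i j; rewrite !mxE (bigD1 i) //= !mxE eqxx big1 ?addr0 /=; last first.
  by move=> k nk; rewrite !mxE eq_sym (negbTE nk) mul0r.
have [] := qpath_linear p; rewrite eqSS.
move: (qsrc p) (qtgt p) (size _) => /= u v s le e.
rewrite -natrM mulnb -!(inj_eq val_inj) /= e; congr ((nat_of_bool _)%:R).
apply/idP/idP => /andP[/eqP e1 /eqP e2]; apply/andP; split; apply/eqP => //; lia.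
Qed.

Lemma scalar_pathD c d : scalar_path (c + d) = scalar_path c + scalar_path d.
Proof. by apply: path_mx_inj; rewrite raddfD /= !scalar_path_mx raddfD. Qed.

Lemma scalar_pathM c d : scalar_path (c * d) = scalar_path c * scalar_path d.
Proof. by apply: path_mx_inj; rewrite path_mxM !scalar_path_mx scalar_mxM. Qed.

Lemma scalar_path1 : scalar_path 1 = 1.
Proof. by apply: path_mx_inj; rewrite path_mx1 !scalar_path_mx. Qed.

Lemma scalar_path_comm c f : scalar_path c * f = f * scalar_path c.
Proof. by apply: path_mx_inj; rewrite [LHS]path_mxM [RHS]path_mxM scalar_path_mx scalar_mxC. Qed.

Lemma idem_path0 : idem_path 0 = 0.
Proof.
by apply: path_mx_inj; rewrite raddf0 idem_path_mx; apply/matrixP => i j; rewrite !mxE andbF.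
Qed.

Lemma idem_pathM p q : idem_path p * idem_path q = if p == q then idem_path p else 0.
Proof.
apply: path_mx_inj; rewrite path_mxM; case: eqVneq => [->|ne].
  rewrite idem_path_mx; apply/matrixP => i j; rewrite !mxE (bigD1 i) //= !mxE eqxx /=.
  rewrite big1 ?addr0 => [|k nk]; last by rewrite !mxE eq_sym (negbTE nk) mul0r.
  by rewrite -natrM mulnb; congr ((nat_of_bool _)%:R); case: (i.+1 == q); rewrite ?andbF ?andbT.
rewrite raddf0 !idem_path_mx; apply/matrixP => i j; rewrite !mxE big1 // => k _.
rewrite !mxE -natrM mulnb; case: eqP => //= e1; case: eqP => //= e2.
by rewrite -e1 e2 (negbTE ne) andbF.
Qed.

Lemma idem_path_sum : \sum_(p < m.+1) idem_path p = 1.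
Proof.
rewrite big_ord_recl idem_path0 add0r; apply: path_mx_inj; rewrite path_mx1 raddf_sum /=.
apply/matrixP => i j; rewrite summxE (bigD1 i) //= idem_path_mx !mxE big1 ?addr0 => [|k nk].
  by rewrite eqxx andbT.
rewrite idem_path_mx mxE /bump /= add1n eqSS.
by rewrite (_ : (i == k :> nat) = false) ?andbF // eq_sym; apply: negbTE.
Qed.

Lemma arrows_idem p : arrows * idem_path p = idem_path p.+1 * arrows.
Proof.
apply: path_mx_inj; rewrite [LHS]path_mxM [RHS]path_mxM !idem_path_mx arrows_mx.
apply/matrixP => i j.
rewrite [LHS]mxE [RHS]mxE (bigD1 j) //= [in RHS](bigD1 i) //= !mxE !eqxx /=.
rewrite !big1 ?addr0 => [|k nk|k nk]; last 2 first.
- by rewrite !mxE eq_sym (negbTE nk) mul0r.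
- by rewrite !mxE (negbTE nk) mulr0.
rewrite -!natrM !mulnb eqSS; congr ((nat_of_bool _)%:R).
by apply/idP/idP => /andP[/eqP e1 /eqP e2]; apply/andP; split; apply/eqP => //; lia.
Qed.

Lemma arrows_ideal : arrow_ideal arrows.
Proof. by move=> v; rewrite arrows_mx mxE; case: eqP => //; lia. Qed.

Local Notation I := (ideal_exp (jacobson_rad KQ) l).
Definition to_Lambda (f : KQ) : L := quot_proj I f.

Lemma to_LambdaD f g : to_Lambda (f + g) = to_Lambda f + to_Lambda g.
Proof. exact: quot_projD. Qed.
Lemma to_LambdaM f g : to_Lambda (f * g) = to_Lambda f * to_Lambda g.
Proof. exact: quot_projM. Qed.
Lemma to_Lambda1 : to_Lambda 1 = 1.
Proof. by []. Qed.
Lemma to_Lambda0 : to_Lambda 0 = 0.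
Proof. by apply: (addrI (to_Lambda 0)); rewrite -to_LambdaD !addr0. Qed.
Lemma to_Lambda_sum (J : Type) (r : seq J) (P : pred J) (F : J -> KQ) :
  to_Lambda (\sum_(i <- r | P i) F i) = \sum_(i <- r | P i) to_Lambda (F i).
Proof. exact: (big_morph _ to_LambdaD to_Lambda0). Qed.

Lemma to_Lambda_arrows : to_Lambda (arrows ^+ l) = 0.
Proof.
by rewrite -to_Lambda0; apply/quot_projP; rewrite subr0; apply/exp_rad_exp/arrows_ideal.
Qed.

Section Operators.
Variable X : rmodType L.
Implicit Types x y : X.

Definition sc (c : K) x : X := (to_Lambda (scalar_path c) : L^c) *: x.
Definition pr (p : nat) x : X := (to_Lambda (idem_path p) : L^c) *: x.
Definition sh x : X := (to_Lambda arrows : L^c) *: x.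

Lemma actA (a b : KQ) x :
  (to_Lambda a : L^c) *: ((to_Lambda b : L^c) *: x) = (to_Lambda (b * a) : L^c) *: x.
Proof. by rewrite scalerA to_LambdaM. Qed.

Lemma scD c x y : sc c (x + y) = sc c x + sc c y. Proof. exact: scalerDr. Qed.
Lemma sc0 c : sc c 0 = 0. Proof. exact: scaler0. Qed.
Lemma prD p x y : pr p (x + y) = pr p x + pr p y. Proof. exact: scalerDr. Qed.
Lemma pr0 p : pr p 0 = 0. Proof. exact: scaler0. Qed.
Lemma shD x y : sh (x + y) = sh x + sh y. Proof. exact: scalerDr. Qed.
Lemma sh0 : sh 0 = 0. Proof. exact: scaler0. Qed.
Lemma scDl c d x : sc (c + d) x = sc c x + sc d x.
Proof. by rewrite /sc scalar_pathD to_LambdaD scalerDl. Qed.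
Lemma sc0l x : sc 0 x = 0.
Proof. by apply: (addrI (sc 0 x)); rewrite -scDl !addr0. Qed.
Lemma sc1 x : sc 1 x = x.
Proof. by rewrite /sc scalar_path1 scale1r. Qed.
Lemma scM c d x : sc c (sc d x) = sc (c * d) x.
Proof. by rewrite /sc actA -scalar_pathM mulrC. Qed.
Lemma pr_sc p c x : pr p (sc c x) = sc c (pr p x).
Proof. by rewrite /pr /sc !actA scalar_path_comm. Qed.
Lemma sh_sc c x : sh (sc c x) = sc c (sh x).
Proof. by rewrite /sh /sc !actA scalar_path_comm. Qed.
Lemma pr_pr p q x : pr p (pr q x) = if p == q then pr p x else 0.
Proof.
rewrite /pr actA idem_pathM eq_sym; case: eqP => [->|_] //.
by rewrite to_Lambda0 scale0r.
Qed.
Lemma pr_sh p x : pr p (sh x) = sh (pr p.+1 x).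
Proof. by rewrite /pr /sh !actA arrows_idem. Qed.
Lemma pr0_eq0 x : pr 0 x = 0.
Proof. by rewrite /pr idem_path0 to_Lambda0 scale0r. Qed.
Lemma sum_pr x : \sum_(p < m.+1) pr p x = x.
Proof. by rewrite -scaler_suml -to_Lambda_sum idem_path_sum scale1r. Qed.
Lemma iter_shE k x : iter k sh x = (to_Lambda (arrows ^+ k) : L^c) *: x.
Proof.
elim: k => [|k IH]; first by rewrite expr0 scale1r.
by rewrite iterS IH /sh actA -exprSr.
Qed.
Lemma sh_nil x : iter l sh x = 0.
Proof. by rewrite iter_shE to_Lambda_arrows scale0r. Qed.

End Operators.

(** The coefficients depend on [a] but not on the module. An additive map commuting with [sc], [pr]
    and [sh] is therefore linear, which is [linear_criterion]. *)
Lemma Lambda_spanE (a : L) : exists c : nat -> nat -> K,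
  forall (X : rmodType L) (x : X), (a : L^c) *: x =
    \sum_(p < m.+1) \sum_(j < l) sc (c p j) (iter j (@sh X) (pr p x)).
Proof.
elim/quot_ringW: a => f; rewrite [f]monalgE -/(to_Lambda _) to_Lambda_sum.
elim/big_rec: _ => [|p a _ [c IH]].
  exists (fun _ _ => 0) => X x; rewrite scale0r big1 // => i _.
  by rewrite big1 // => j _; rewrite sc0l.
set q := (qsrc p : 'I_m).+1; set k := size (qarrows p).
exists (fun p' j => c p' j + (if (p' == q) && (j == k) then f@_p else 0)) => X x.
rewrite scalerDl addrC IH path_monomialE -/q -/k.
have -> : (to_Lambda (scalar_path f@_p * (idem_path q * arrows ^+ k)) : L^c) *: x =
          sc f@_p (iter k (@sh X) (pr q x)).
  rewrite iter_shE /pr [X in sc _ X]actA; apply: etrans (esym (actA _ _ _)).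
  exact: (congr1 (fun u : KQ => (to_Lambda u : L^c) *: x)
            (scalar_path_comm f@_p (idem_path q * arrows ^+ k))).
under [RHS]eq_bigr => i _ do (under eq_bigr => j _ do rewrite scDl; rewrite big_split).
rewrite big_split /=; congr (_ + _).
have q_lt : (q < m.+1)%N by rewrite ltnS /q; case: (qsrc p).
have [kl|lk] := ltnP k l; last first.
  have -> : iter k (@sh X) (pr q x) = 0.
    by rewrite -(subnK lk) iterD sh_nil; elim: (k - l)%N => //= d ->; rewrite sh0.
  rewrite sc0 big1 // => i _; rewrite big1 // => j _.
  by rewrite (_ : (j == k :> nat) = false) ?andbF ?sc0l //; have := ltn_ord j; lia.
rewrite (bigD1 (Ordinal q_lt)) //= (bigD1 (Ordinal kl)) //= !eqxx /= !big1 ?addr0 //.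
- move=> i ni; rewrite big1 // => j _; case: eqP => e; rewrite ?sc0l //.
  by case/eqP: ni; apply: val_inj.
- move=> j nj; case: eqP => e; rewrite ?andbF ?sc0l //.
  by case/eqP: nj; apply: val_inj.
Qed.

Lemma sc_linear (X Y : rmodType L) (h : {linear X -> Y}) c x : h (sc c x) = sc c (h x).
Proof. by rewrite /sc linearZ. Qed.
Lemma pr_linear (X Y : rmodType L) (h : {linear X -> Y}) p x : h (pr p x) = pr p (h x).
Proof. by rewrite /pr linearZ. Qed.
Lemma iter_sh_linear (X Y : rmodType L) (h : {linear X -> Y}) k x :
  h (iter k (@sh X) x) = iter k (@sh Y) (h x).
Proof. by rewrite !iter_shE linearZ. Qed.

End Generators.

Arguments sc {K m l X} c x.
Arguments pr {K m l X} p x.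
Arguments sh {K m l X} x.

Section Graded.
Local Open Scope ring_scope.
Variables (K : fieldType) (m l : nat).
Local Notation L := (Lambda K m l).

Lemma sc_sum (X : rmodType L) c (J : Type) (r : seq J) (P : pred J) (F : J -> X) :
  sc c (\sum_(i <- r | P i) F i) = \sum_(i <- r | P i) sc c (F i).
Proof. exact: (big_morph _ (@scD _ _ _ _ c) (@sc0 _ _ _ _ c)). Qed.
Lemma pr_sum (X : rmodType L) c (J : Type) (r : seq J) (P : pred J) (F : J -> X) :
  pr c (\sum_(i <- r | P i) F i) = \sum_(i <- r | P i) pr c (F i).
Proof. exact: (big_morph _ (@prD _ _ _ _ c) (@pr0 _ _ _ _ c)). Qed.
Lemma sh_sum (X : rmodType L) (J : Type) (r : seq J) (P : pred J) (F : J -> X) :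
  sh (\sum_(i <- r | P i) F i) = \sum_(i <- r | P i) sh (F i).
Proof. exact: (big_morph _ (@shD _ _ _ _) (@sh0 _ _ _ _)). Qed.

Lemma iter_sh0 (X : rmodType L) k : iter k sh 0 = 0 :> X.
Proof. by elim: k => //= k ->; rewrite sh0. Qed.
Lemma iter_shD (X : rmodType L) k (x y : X) :
  iter k sh (x + y) = iter k sh x + iter k sh y.
Proof. by elim: k => //= k ->; rewrite shD. Qed.
Lemma iter_sh_sum (X : rmodType L) k (J : Type) (r : seq J) (P : pred J) (F : J -> X) :
  iter k sh (\sum_(i <- r | P i) F i) = \sum_(i <- r | P i) iter k sh (F i).
Proof. exact: (big_morph _ (@iter_shD _ k) (iter_sh0 _ k)). Qed.
Lemma iter_sh_sc (X : rmodType L) k c (x : X) : iter k sh (sc c x) = sc c (iter k sh x).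
Proof. by elim: k => //= k ->; rewrite sh_sc. Qed.
Lemma iter_sh_ge (X : rmodType L) k k' (x : X) :
  (k <= k')%N -> iter k sh x = 0 -> iter k' sh x = 0.
Proof. by move=> le e; rewrite -(subnK le) iterD e iter_sh0. Qed.
Lemma pr_iter_sh (X : rmodType L) p k (x : X) :
  pr p (iter k sh x) = iter k sh (pr (p + k) x).
Proof.
elim: k p => [|k IH] p; first by rewrite addn0.
by rewrite iterS pr_sh IH addSnnS.
Qed.

Definition deg (X : rmodType L) p (x : X) := pr p x = x.

Lemma deg_pr (X : rmodType L) p (x : X) : deg p (pr p x).
Proof. by rewrite /deg pr_pr eqxx. Qed.
Lemma deg0 (X : rmodType L) p : deg p (0 : X).
Proof. exact: pr0. Qed.
Lemma degD (X : rmodType L) p (x y : X) : deg p x -> deg p y -> deg p (x + y).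
Proof. by rewrite /deg prD => -> ->. Qed.
Lemma deg_sc (X : rmodType L) p c (x : X) : deg p x -> deg p (sc c x).
Proof. by rewrite /deg pr_sc => ->. Qed.
Lemma deg_sum (X : rmodType L) p (J : Type) (r : seq J) (P : pred J) (F : J -> X) :
  (forall i, P i -> deg p (F i)) -> deg p (\sum_(i <- r | P i) F i).
Proof. by move=> d; rewrite /deg pr_sum; apply: eq_bigr. Qed.
Lemma pr_deg (X : rmodType L) p q (x : X) : deg q x -> pr p x = if p == q then x else 0.
Proof. by move=> <-; rewrite pr_pr; case: eqP => [->|]. Qed.
Lemma deg_iter_sh (X : rmodType L) p k (x : X) : deg (p + k) x -> deg p (iter k sh x).
Proof. by rewrite /deg pr_iter_sh => ->. Qed.
Lemma iter_sh_deg (X : rmodType L) p k (x : X) : deg p x -> (p <= k)%N -> iter k sh x = 0.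
Proof.
move=> dx le; apply: iter_sh_ge le _.
have : deg 0 (iter p sh x) by apply: deg_iter_sh.
by rewrite /deg pr0_eq0.
Qed.
Lemma deg_linear (X Y : rmodType L) (h : {linear X -> Y}) p (x : X) :
  deg p x -> deg p (h x).
Proof. by rewrite /deg -pr_linear => ->. Qed.

Lemma linear_criterion (X Y : rmodType L) (h : X -> Y) :
  (forall x y, h (x + y) = h x + h y) -> (forall c x, h (sc c x) = sc c (h x)) ->
  (forall p x, h (pr p x) = pr p (h x)) -> (forall x, h (sh x) = sh (h x)) ->
  linear h.
Proof.
move=> hD hsc hpr hsh.
have h0 : h 0 = 0 by apply: (addrI (h 0)); rewrite -hD !addr0.
have h_sum J (r : seq J) (P : pred J) (F : J -> X) :
    h (\sum_(i <- r | P i) F i) = \sum_(i <- r | P i) h (F i).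
  exact: (big_morph _ hD h0).
have hit k x : h (iter k sh x) = iter k sh (h x) by elim: k => //= k <-.
move=> a x y; rewrite hD; congr (_ + _).
have [c cE] := Lambda_spanE a; rewrite !cE h_sum; apply: eq_bigr => p _.
by rewrite h_sum; apply: eq_bigr => j _; rewrite hsc hit hpr.
Qed.

End Graded.

(** * Interval modules *)

Section IntervalModule.
Local Open Scope ring_scope.
Variables (K : fieldType) (m l : nat).
Local Notation Q := (linear_quiver m).
Local Notation KQ := (path_alg K Q).
Local Notation L := (Lambda K m l).
Variables b a : nat.

(* The indecomposable module with one-dimensional components in the degrees [p]
   with [b < p <= a]; the basis vector [j] sits in degree [a - j]. Parameters
   without such a module ([a > m] or [a - b > l]) give a truncation, so that
   the instances below need no hypotheses. *)
Definition idim : nat := if (a <= m)%N then minn (a - b) (minn l a) else 0.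

Fact ivert_subproof (i : 'I_idim) : (a.-1 - i < m)%N.
Proof. by case: i => i /=; rewrite /idim; case: ifP; lia. Qed.
Definition ivert (i : 'I_idim) : 'I_m := Ordinal (ivert_subproof i).

Lemma ivertE (i : 'I_idim) : (ivert i + i).+1 = a.
Proof. by case: i => i /=; rewrite /idim; case: ifP => /=; lia. Qed.

Lemma ivert_inj : injective ivert.
Proof.
move=> i j e; apply: val_inj => /=; have := ivertE i; have := ivertE j.
by rewrite e; lia.
Qed.

Definition iact (f : KQ) : 'M[K]_idim := \matrix_(i, j) path_mx f (ivert i) (ivert j).

Lemma iactD f g : iact (f + g) = iact f + iact g.
Proof. by apply/matrixP => i j; rewrite !mxE raddfD mxE. Qed.
Lemma iactB f g : iact (f - g) = iact f - iact g.
Proof. by apply/matrixP => i j; rewrite !mxE raddfB !mxE. Qed.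
Lemma iact1 : iact 1 = 1%:M.
Proof.
by apply/matrixP => i j; rewrite !mxE path_mx1 mxE (inj_eq ivert_inj).
Qed.

(** Cutting a matrix down to some of the vertices is multiplicative here because these vertices are
    consecutive: by triangularity, a path between two of them meets no other vertex. *)
Lemma iactM f g : iact (f * g) = iact f *m iact g.
Proof.
apply/matrixP => i j; rewrite !mxE path_mxM mxE.
rewrite (bigID (mem (ivert @: [set: 'I_idim]))) /= [X in _ + X]big1 ?addr0.
  rewrite big_imset /=; last by move=> x y _ _; apply: ivert_inj.
  by apply: eq_big => [k|k _]; rewrite ?in_setT // !mxE.
move=> w nw; have [le|lt] := leqP w (ivert i); last by rewrite path_mx_trig ?mul0r.
have [lt|le'] := ltnP w (ivert j); first by rewrite [X in _ * X]path_mx_trig ?mulr0.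
case/negP: nw; have ei := ivertE i; have ej := ivertE j; have lj := ltn_ord j.
have lt : (a.-1 - w < idim)%N by lia.
apply/imsetP; exists (Ordinal lt); first by rewrite in_setT.
by apply: ord_inj => /=; lia.
Qed.

Lemma iact_rad f : ideal_exp (jacobson_rad KQ) l f -> iact f = 0.
Proof.
move=> /rad_exp_deep df; apply/matrixP => i j; rewrite !mxE df //.
have dl : (idim <= l)%N by rewrite /idim; case: ifP; lia.
by have := ivertE i; have := ivertE j; have := ltn_ord j; lia.
Qed.

Definition imod : Type := 'rV[K]_idim.
HB.instance Definition _ := GRing.Zmodule.on imod.

Definition iscale (x : L^c) (w : imod) : imod := w *m iact (repr (x : L)).

Lemma iact_repr (f : KQ) : iact (repr (to_Lambda l f)) = iact f.
Proof.
apply/eqP; rewrite eq_sym -subr_eq0 -iactB; apply/eqP/iact_rad/quot_projP.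
by rewrite /quot_proj reprK.
Qed.

Lemma iscaleA (x y : L^c) (w : imod) : iscale x (iscale y w) = iscale (x * y) w.
Proof.
rewrite /iscale -mulmxA -iactM; congr (_ *m _).
by rewrite -iact_repr to_LambdaM /to_Lambda /quot_proj !reprK.
Qed.
Lemma iscale1 : left_id (1 : L^c) iscale.
Proof.
move=> w; rewrite /iscale -[RHS]mulmx1 -iact1 -[RHS]/(w *m iact 1) -(iact_repr 1).
by rewrite to_Lambda1.
Qed.
Lemma iscaleDr : right_distributive iscale +%R.
Proof. by move=> x u v; apply: mulmxDl. Qed.
Lemma iscaleDl w : {morph iscale^~ w : x y / x + y}.
Proof.
move=> x y; rewrite /iscale -mulmxDr -iactD; congr (_ *m _).
by rewrite -[RHS]iact_repr to_LambdaD /to_Lambda /quot_proj !reprK.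
Qed.
HB.instance Definition _ := GRing.Zmodule_isLmodule.Build L^c imod
  iscaleA iscale1 iscaleDr iscaleDl.

Lemma imod_act (f : KQ) (w : imod) : (to_Lambda l f : L^c) *: w = w *m iact f.
Proof. by rewrite -iact_repr. Qed.

Lemma imod_sc c (w : imod) j : (sc c w : imod) 0 j = c * w 0 j.
Proof.
rewrite /sc imod_act (_ : iact _ = c%:M) ?mul_mx_scalar ?mxE //.
by apply/matrixP => i k; rewrite !mxE scalar_path_mx mxE (inj_eq ivert_inj).
Qed.

Lemma imod_pr p (w : imod) j : (pr p w : imod) 0 j = if (p + j)%N == a then w 0 j else 0.
Proof.
rewrite /pr imod_act mxE (bigD1 j) //= big1 ?addr0 => [|i ni]; rewrite mxE idem_path_mx mxE.
  rewrite eqxx /=; have := ivertE j => e.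
  rewrite (_ : (_ == p) = ((p + j)%N == a)); last by apply/eqP/eqP; lia.
  by case: ifP; rewrite ?mulr1 ?mulr0.
by rewrite (inj_eq ivert_inj) (negbTE ni) mulr0.
Qed.

Lemma imod_sh (w : imod) j :
  (sh w : imod) 0 j = \sum_(i < idim) (if i.+1 == j then w 0 i else 0).
Proof.
rewrite /sh imod_act mxE; apply: eq_bigr => i _; rewrite mxE arrows_mx mxE.
have := ivertE j; have := ivertE i => ei ej.
rewrite (_ : (_ == _) = (i.+1 == j)); last by apply/eqP/eqP; lia.
by case: ifP; rewrite ?mulr1 ?mulr0.
Qed.

Definition igen : imod := \row_j (j == 0 :> nat)%:R.

Lemma iter_sh_igen k j : (iter k sh igen : imod) 0 j = (j == k :> nat)%:R.
Proof.
elim: k j => [|k IH] j; first by rewrite mxE.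
rewrite iterS imod_sh; under eq_bigr do rewrite IH.
case: eqP => e.
  have lt : (k < idim)%N by have := ltn_ord j; lia.
  rewrite (bigD1 (Ordinal lt)) //= e !eqxx big1 ?addr0 // => i ni.
  by case: eqP => // -[ei]; case/eqP: ni; apply: val_inj.
by rewrite big1 // => i _; case: eqP => // ei; case: eqP => // ek; case: e; lia.
Qed.

Lemma imodE (w : imod) : w = \sum_(j < idim) sc (w 0 j) (iter j sh igen).
Proof.
apply/rowP => k; rewrite summxE (bigD1 k) //= imod_sc iter_sh_igen eqxx mulr1.
rewrite big1 ?addr0 // => i ni; rewrite imod_sc iter_sh_igen (_ : (_ == _) = false) ?mulr0 //.
by rewrite eq_sym; apply: negbTE.
Qed.

Lemma deg_igen : deg a igen.
Proof.
by apply/rowP => j; rewrite imod_pr; case: eqP => // e; rewrite mxE; case: eqP => //; lia.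
Qed.

Lemma imod_hom_idim (X : rmodType L) (x : X) : deg a x -> iter idim sh x = 0 ->
  exists h : {linear imod -> X}, h igen = x.
Proof.
move=> dx x0; pose h (w : imod) : X := \sum_(j < idim) sc (w 0 j) (iter j sh x).
have h_lin : linear h.
  apply: linear_criterion.
  - by move=> u v; rewrite /h -big_split; apply: eq_bigr => j _; rewrite mxE scDl.
  - move=> c u; rewrite /h sc_sum; apply: eq_bigr => j _.
    by rewrite imod_sc scM.
  - move=> p u; rewrite /h pr_sum; apply: eq_bigr => j _.
    rewrite imod_pr pr_sc pr_iter_sh (pr_deg _ dx).
    by case: ifP; rewrite // iter_sh0 sc0 sc0l.
  - move=> u; rewrite /h sh_sum.
    transitivity (\sum_(j < idim) \sum_(i < idim)
        (if i.+1 == j then sc (u 0 i) (sh (iter i sh x)) else 0)).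
      apply: eq_bigr => j _; rewrite imod_sh.
      rewrite (big_morph (fun c => sc c (iter j sh x)) (fun c d => scDl c d _) (sc0l _)).
      apply: eq_bigr => i _; case: eqP => [<-|_] //; exact: sc0l.
    rewrite exchange_big; apply: eq_bigr => i _ /=; rewrite sh_sc.
    have [lt|le] := ltnP i.+1 idim.
      rewrite (bigD1 (Ordinal lt)) //= eqxx big1 ?addr0 // => j nj.
      by case: eqP => // e; case/eqP: nj; apply: val_inj.
    rewrite big1 => [|j _]; first by rewrite -iterS (iter_sh_ge le) ?sc0.
    by case: eqP => // e; have := ltn_ord j; lia.
exists (HB.pack h (GRing.isLinear.Build L^c imod X *:%R h h_lin) : {linear imod -> X}) => /=.
rewrite /h; have [lt|le] := ltnP 0 idim.
  rewrite (bigD1 (Ordinal lt)) //= mxE eqxx sc1 big1 ?addr0 // => j nj.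
  rewrite mxE (_ : (_ == _) = false) ?sc0l //; exact: negbTE.
rewrite big1 => [|j _]; last by have := ltn_ord j; lia.
by rewrite -x0; move: le; rewrite leqn0 => /eqP ->.
Qed.

Hypotheses (ba : (b <= a)%N) (am : (a <= m)%N) (abl : (a - b <= l)%N).

Lemma idimE : idim = (a - b)%N.
Proof. by rewrite /idim am; lia. Qed.

Lemma iter_sh_igen0 : iter (a - b) sh igen = 0.
Proof.
by apply/rowP => j; rewrite iter_sh_igen mxE -idimE (_ : (_ == _) = false) // ltn_eqF.
Qed.

Lemma imod_span (w : imod) :
  exists c : nat -> K, w = \sum_(j < a - b) sc (c j) (iter j sh igen).
Proof.
exists (fun k => if insub k is Some j then w 0 j else 0).
rewrite -idimE {1}(imodE w); apply: eq_bigr => j _.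
by rewrite (valK j).
Qed.

Lemma imod_free (c : nat -> K) :
  \sum_(j < a - b) sc (c j) (iter j sh igen) = 0 -> forall j, (j < a - b)%N -> c j = 0.
Proof.
rewrite -idimE => e j lt; have := congr1 (fun w : imod => w 0 (Ordinal lt)) e.
rewrite summxE (bigD1 (Ordinal lt)) //= imod_sc iter_sh_igen eqxx mulr1 mxE.
rewrite big1 ?addr0 // => i ni; rewrite imod_sc iter_sh_igen (_ : (_ == _) = false) ?mulr0 //.
by rewrite eq_sym; apply: negbTE.
Qed.

Lemma imod_hom (X : rmodType L) (x : X) : deg a x -> iter (a - b) sh x = 0 ->
  exists h : {linear imod -> X}, h igen = x.
Proof. by rewrite -idimE; apply: imod_hom_idim. Qed.

Lemma imod_hom_ext (X : rmodType L) (h h' : {linear imod -> X}) :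
  h igen = h' igen -> h =1 h'.
Proof.
move=> e w; have [c ->] := imod_span w; rewrite !linear_sum; apply: eq_bigr => j _.
by rewrite !sc_linear !iter_sh_linear e.
Qed.

Lemma imod_degE p (w : imod) : deg p w ->
  if (b < p <= a)%N then exists c, w = sc c (iter (a - p) sh igen) else w = 0.
Proof.
move=> dw; have [c e] := imod_span w; rewrite -dw {1 2}e pr_sum.
have E (j : 'I_(a - b)) : pr p (sc (c j) (iter j sh igen)) =
    if (p + j)%N == a then sc (c j) (iter j sh igen) else 0.
  rewrite pr_sc pr_iter_sh (pr_deg _ deg_igen); case: ifP => //.
  by rewrite iter_sh0 sc0.
under eq_bigr do rewrite E.
case: ifP => [/andP[bp pa]|/negP h].
  have lt : (a - p < a - b)%N by lia.
  exists (c (a - p)%N); rewrite (bigD1 (Ordinal lt)) //= subnKC // eqxx big1 ?addr0 //.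
  move=> i ni; case: eqP => // ei; case/eqP: ni; apply: val_inj => /=; lia.
rewrite big1 // => j _; case: eqP => // ej; case: h; have := ltn_ord j; lia.
Qed.

End IntervalModule.

(* The minimal projective resolution of [imod b a] has the terms
   [imod (x - l) x] with [x = syz l b a i], and its [i]th syzygy is
   [imod (syz l b a i.+1) (syz l b a i)]. *)
Fixpoint syz (l b a i : nat) : nat :=
  match i with 0 => a | 1 => b | i'.+2 => syz l b a i' - l end.

Lemma syzSS l b a i : syz l b a i.+2 = syz l b a i - l. Proof. by []. Qed.

Lemma syz_le l b a i : b <= a -> a - b <= l ->
  syz l b a i.+1 <= syz l b a i /\ syz l b a i - l <= syz l b a i.+1.
Proof.
move=> ba abl; elim: i => [|i [IH1 IH2]]; first by split=> /=; lia.
by rewrite syzSS; lia.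
Qed.

Lemma syz_max l b a i : b <= a -> a - b <= l -> syz l b a i <= a.
Proof.
move=> ba abl; elim: i => // i IH.
by have [le _] := syz_le i ba abl; apply: leq_trans IH.
Qed.

(** * Projective resolutions of interval modules and Ext out of them *)

Section IntervalExt.
Local Open Scope ring_scope.
Variables (K : fieldType) (m l : nat).
Local Notation L := (Lambda K m l).
Local Notation imod := (imod K m l).
Local Notation igen := (igen K m l).
Local Notation pmod p := (imod (p - l) p).

(** The defining relation of [pmod p] holds for every element of degree [p]: [l] shifts vanish by
    nilpotency, and if [p < l] then [p] shifts already lead to degree 0. So Hom out of [pmod p] is
    the degree [p] part, and [pmod p] is projective. *)
Lemma pmod_hom p (X : rmodType L) (x : X) : (p <= m)%N -> deg p x ->
  exists h : {linear pmod p -> X}, h (igen (p - l) p) = x.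
Proof.
move=> pm dx; apply: imod_hom => //; try lia.
have [lp|pl] := leqP l p; first by rewrite subKn // sh_nil.
by apply: (iter_sh_deg dx); lia.
Qed.

Lemma pmod_projective p : (p <= m)%N -> projective (pmod p).
Proof.
move=> pm X Y g f gs; have dg := deg_igen K m l (p - l) p.
have [x xE] := gs (f (igen (p - l) p)).
have [h hE] := pmod_hom pm (deg_pr p x).
exists h; apply: (@imod_hom_ext _ _ _ _ _ _ _ _ _ (g \o h : {linear _ -> _}) f) => //; try lia.
by rewrite /= hE pr_linear xE; apply: deg_linear.
Qed.

Lemma homog_image (X Y : rmodType L) (d : {linear X -> Y}) (w : Y) :
  (forall p, exists x, d x = pr p w) -> exists x, d x = w.
Proof.
move=> im; have [f fE] := choice im.
exists (\sum_(p < m.+1) f p); rewrite linear_sum -[RHS]sum_pr.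
exact: eq_bigr.
Qed.

Lemma imod_free1 b a c j : (b <= a)%N -> (a <= m)%N -> (a - b <= l)%N -> (j < a - b)%N ->
  sc c (iter j sh (igen b a)) = 0 -> c = 0.
Proof.
move=> ba am abl lt e.
have := @imod_free K m l b a ba am abl (fun k => if k == j then c else 0) _ j lt.
rewrite eqxx; apply; rewrite (bigD1 (Ordinal lt)) //= eqxx e big1 ?addr0 // => i ni.
by rewrite (_ : (_ == _) = false) ?sc0l //; apply: negbTE.
Qed.

(** Degree by degree: [d] kills the degrees up to [b2] and is injective above them, and the image of
    [d'] consists of the degrees in [(b1, b2]]. *)
Lemma imod_exact b1 a1 b2 a2 b3 (d : {linear imod b1 a1 -> imod b2 a2})
    (d' : {linear imod b3 b2 -> imod b1 a1}) :
  (b3 <= b1)%N -> (b1 <= b2)%N -> (b2 <= a1)%N -> (a1 <= a2)%N -> (a2 <= m)%N ->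
  (a1 - b1 <= l)%N -> (a2 - b2 <= l)%N -> (b2 - b3 <= l)%N ->
  d (igen b1 a1) = iter (a2 - a1) sh (igen b2 a2) ->
  d' (igen b3 b2) = iter (a1 - b2) sh (igen b1 a1) ->
  forall w, d w = 0 <-> exists y, d' y = w.
Proof.
move=> le31 le12 le21 le22 a2m l1 l2 l3 dE d'E w; split=> [dw|[y <-]]; last first.
  have [c ->] := imod_span (leq_trans le31 le12) (leq_trans le21 (leq_trans le22 a2m)) l3 y.
  rewrite !linear_sum big1 // => j _; rewrite !sc_linear !iter_sh_linear d'E.
  rewrite iter_sh_linear dE -!iterD (_ : iter _ _ _ = 0) ?sc0 //.
  apply: (@iter_sh_ge _ _ _ _ (a2 - b2)); first lia.
  by apply: iter_sh_igen0; lia.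
apply: homog_image => p.
have dp : d (pr p w) = 0 by rewrite pr_linear dw pr0.
have := imod_degE (leq_trans le12 le21) (leq_trans le22 a2m) l1 (deg_pr p w).
case: ifP => [/andP[bp pa] [c e]|_ ->]; last by exists 0; rewrite linear0.
have [pb|bp2] := leqP p b2.
  exists (sc c (iter (b2 - p) sh (igen b3 b2))).
  rewrite sc_linear iter_sh_linear d'E -iterD e; congr (sc _ (iter _ _ _)); lia.
exists 0; rewrite linear0 e.
have -> : c = 0; last by rewrite sc0l.
apply: (@imod_free1 b2 a2 c (a2 - p)) => //; try lia.
rewrite -dp e sc_linear iter_sh_linear dE -iterD; congr (sc _ (iter _ _ _)); lia.
Qed.

(** Exactness in the middle of X_p -> X_q -> X_r, the maps being powers of [sh]. Since Hom from
    [pmod p] to [X] is X_p, this is a piece of the Hom complex of a resolution with terms [pmod p],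
    [pmod q], [pmod r]. *)
Definition exact_at (X : rmodType L) (p q r : nat) : Prop :=
  forall y : X, deg q y -> iter (q - r) sh y = 0 ->
    exists2 z, deg p z & iter (p - q) sh z = y.

Section Resolution.
Variables b a : nat.
Hypotheses (ba : (b <= a)%N) (am : (a <= m)%N) (abl : (a - b <= l)%N).
Local Notation x := (syz l b a).

Lemma syz_m i : (x i <= m)%N.
Proof. exact: leq_trans (syz_max i ba abl) am. Qed.

Lemma pmod_diff_ex i : exists d : {linear pmod (x i.+1) -> pmod (x i)},
  d (igen _ _) = iter (x i - x i.+1) sh (igen _ _).
Proof.
apply: pmod_hom (syz_m _) _; apply: deg_iter_sh.
have [le _] := syz_le i ba abl.
by rewrite subnKC //; apply: deg_igen.
Qed.

Lemma pmod_aug_ex : exists d : {linear pmod a -> imod b a}, d (igen _ _) = igen _ _.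
Proof. by apply: pmod_hom am _; apply: deg_igen. Qed.

Definition pmod_diff i := sval (cid (pmod_diff_ex i)).
Definition pmod_aug := sval (cid pmod_aug_ex).
Lemma pmod_diffE i : pmod_diff i (igen _ _) = iter (x i - x i.+1) sh (igen _ _).
Proof. exact: svalP (cid (pmod_diff_ex i)). Qed.
Lemma pmod_augE : pmod_aug (igen _ _) = igen _ _.
Proof. exact: svalP (cid pmod_aug_ex). Qed.

Definition imod_resolution : proj_resolution (imod b a).
Proof.
refine (@ProjResolution _ (imod b a) (fun i => pmod (x i)) pmod_diff pmod_aug _ _ _ _).
- by move=> i; apply: pmod_projective; apply: syz_m.
- move=> w; have [c ->] := imod_span ba am abl w.
  exists (\sum_(j < a - b) sc (c j) (iter j sh (igen (a - l) a))).
  rewrite linear_sum; apply: eq_bigr => j _.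
  by rewrite sc_linear iter_sh_linear pmod_augE.
- apply: (@imod_exact _ _ _ _ (b - l)%N); rewrite ?pmod_augE ?pmod_diffE ?subnn //; rewrite /=; lia.
- move=> i; have [le1 le2] := syz_le i ba abl; have xm := syz_m i.
  apply: (@imod_exact _ _ _ _ (x i.+2 - l)%N); rewrite ?pmod_diffE //; rewrite ?syzSS; lia.
Defined.

Lemma Ext_zero_imod (X : rmodType L) i :
  Ext_zero i.+1 (imod b a) X <-> exact_at X (x i) (x i.+1) (x i.+2).
Proof.
rewrite (Ext_zeroP X imod_resolution); split=> [Z y dy y0|Z f fc].
  have [f fE] := pmod_hom (syz_m i.+1) dy.
  have [w|g gE] := Z f.
    apply: (@imod_hom_ext _ _ _ _ _ _ _ _ _ (f \o pmod_diff i.+1 : {linear _ -> _})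
      (\0 : {linear _ -> _})) => //; rewrite ?syz_m //; try lia.
    by rewrite [LHS]/= pmod_diffE iter_sh_linear fE y0.
  exists (g (igen _ _)); first by apply: deg_linear; apply: deg_igen.
  by rewrite -iter_sh_linear -pmod_diffE -fE; apply/esym/gE.
have [|z dz zE] := Z (f (igen _ _)) (deg_linear _ (deg_igen _ _ _ _ _)).
  by rewrite -iter_sh_linear -pmod_diffE; apply: fc.
have [g gE] := pmod_hom (syz_m i) dz.
exists g; apply: (@imod_hom_ext _ _ _ _ _ _ _ _ _ f (g \o pmod_diff i : {linear _ -> _})) => //;
  rewrite ?syz_m //; try lia.
by rewrite /= pmod_diffE iter_sh_linear gE zE.
Qed.

End Resolution.
End IntervalExt.

(** * Decomposition into interval modules *)

Section Decomposition.
Local Open Scope ring_scope.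
Variables (K : fieldType) (m l : nat).
Local Notation L := (Lambda K m l).
Local Notation imod := (imod K m l).
Local Notation igen := (igen K m l).

Fixpoint isum (s : seq (nat * nat)) : rmodType L :=
  if s is (b, a) :: s' then (imod b a * isum s')%type else imod 0 0.

Definition interval (ba : nat * nat) : bool :=
  [&& ba.1 < ba.2, ba.2 <= m & ba.2 - ba.1 <= l]%N.

Lemma scN1 (X : rmodType L) (x : X) : sc (-1) x = - x.
Proof. by apply: (addrI x); rewrite -{1}[x]sc1 -scDl subrr sc0l subrr. Qed.

Section Families.
Variables (X : rmodType L) (I : finType) (a : I -> nat).

(** [d i] only bounds the length of [g i]; the sum of these bounds is what the exchange decreases.
    Generation is stated as an induction principle, which passes easily to a family with one
    generator replaced. *)
Record family (d : I -> nat) (g : I -> X) : Prop := Family {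
  fam_deg : forall i, deg (a i) (g i);
  fam_nil : forall i, iter (d i) sh (g i) = 0;
  fam_bounds : forall i, [/\ d i <= a i, a i <= m & d i <= l]%N;
  fam_gen : forall U : X -> Prop, U 0 -> (forall x y, U x -> U y -> U (x + y)) ->
    (forall c x, U x -> U (sc c x)) -> (forall x, U x -> U (sh x)) ->
    (forall i, U (g i)) -> forall x, U x }.

Definition combination (d : I -> nat) (g : I -> X) (c : I -> nat -> K) : X :=
  \sum_i \sum_(j < d i) sc (c i j) (iter j sh (g i)).

Definition independent d g := forall c, combination d g c = 0 ->
  forall i j, (j < d i)%N -> c i j = 0.

Lemma family_span d g : family d g -> forall x, exists c, x = combination d g c.
Proof.
case=> _ nil _ gen; apply: gen.
- exists (fun _ _ => 0); rewrite /combination big1 // => i _.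
  by rewrite big1 // => j _; rewrite sc0l.
- move=> _ _ [c ->] [c' ->]; exists (fun i j => c i j + c' i j).
  rewrite -big_split; apply: eq_bigr => i _ /=.
  by rewrite -big_split; apply: eq_bigr => j _; rewrite /= scDl.
- move=> e _ [c ->]; exists (fun i j => e * c i j).
  rewrite sc_sum; apply: eq_bigr => i _.
  by rewrite sc_sum; apply: eq_bigr => j _; rewrite scM.
- move=> _ [c ->]; exists (fun i j => if j is j'.+1 then c i j' else 0).
  rewrite sh_sum; apply: eq_bigr => i _; rewrite sh_sum.
  case: (d i) (nil i) => [|n] e; first by rewrite !big_ord0.
  rewrite big_ord_recr [RHS]big_ord_recl /= sc0l add0r.
  rewrite sh_sc -iterS e sc0 addr0.
  by apply: eq_bigr => j _; rewrite sh_sc.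
- move=> i; exists (fun i' j => if (i' == i) && (j == 0%N) then 1 else 0).
  rewrite /combination (bigD1 i) //= [X in _ + X]big1 ?addr0; last first.
    by move=> i' /negbTE ni; rewrite big1 // => j _; rewrite ni sc0l.
  case: (d i) (nil i) => [|n] e; first by rewrite big_ord0.
  by rewrite big_ord_recl /= eqxx sc1 big1 ?addr0 // => j _; rewrite andbF sc0l.
Qed.

(* In a homogeneous relation, the generator [g i1] of least degree occurs
   undivided up to a power of [sh], and replacing it by the corresponding
   combination [g1] shortens its length. *)
Lemma family_exchange d g : family d g -> ~ independent d g ->
  exists d' g', family d' g' /\ (\sum_i d' i < \sum_i d i)%N.
Proof.
case=> dg nil bnd gen /existsNP[c /not_implyP[c0]].
move=> /existsNP[i0 /existsNP[j0 /not_implyP[lt0 nc0]]].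
(* The degree of a term with nonzero coefficient. In this degree every generator contributes at most
   one term, whose coefficient is [ga i]. *)
set w := (a i0 - j0)%N.
pose ga i := if ((w <= a i) && (a i - w < d i))%N then c i (a i - w)%N else 0.
have ga_rel : \sum_i sc (ga i) (iter (a i - w) sh (g i)) = 0.
  have := congr1 (pr w) c0; rewrite pr0 pr_sum => e0; rewrite -[RHS]e0.
  apply: eq_bigr => i _.
  rewrite pr_sum.
  have E (j : 'I_(d i)) : pr w (sc (c i j) (iter j sh (g i))) =
      if (w + j == a i)%N then sc (c i j) (iter j sh (g i)) else 0.
    rewrite pr_sc pr_iter_sh (pr_deg _ (dg i)); case: ifP => //.
    by rewrite iter_sh0 sc0.
  under [RHS]eq_bigr do rewrite E.
  rewrite /ga; case: ifP => [/andP[wa lt]|/negP h]; last first.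
    rewrite sc0l big1 // => j _; case: eqP => // e; case: h.
    by have := ltn_ord j; lia.
  rewrite (bigD1 (Ordinal lt)) //= subnKC // eqxx big1 ?addr0 //.
  by move=> j nj; case: eqP => // e; case/eqP: nj; apply: val_inj => /=; lia.
have [b0 _ _] := bnd i0.
have ga0 : ga i0 != 0.
  rewrite /ga /w subKn; last lia.
  by rewrite leq_subr lt0; apply/eqP.
have [i1 ga1 i1min] := @arg_minnP _ i0 (fun i => ga i != 0) a ga0.
have gaP i : ga i != 0 -> [/\ w <= a i1, a i1 <= a i & a i - w < d i]%N.
  move=> nz; have := i1min i nz; move: nz ga1; rewrite /ga.
  case: ifP => [/andP[le lt] _|_ /eqP//]; case: ifP => [/andP[le1 lt1] _|_ /eqP//].
  by split.
have [le1 _ lt1] := gaP _ ga1.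
pose g1 := \sum_i sc (ga i) (iter (a i - a i1) sh (g i)).
have g1_nil : iter (a i1 - w) sh g1 = 0.
  rewrite iter_sh_sum -[RHS]ga_rel; apply: eq_bigr => i _; rewrite iter_sh_sc -iterD.
  have [->|/gaP[_ le _]] := eqVneq (ga i) 0; first by rewrite !sc0l.
  congr (sc _ (iter _ _ _)); lia.
exists (fun i => if i == i1 then (a i1 - w)%N else d i),
       (fun i => if i == i1 then g1 else g i); split.
  split.
  - move=> i; case: eqP => [->|_]; last exact: dg.
    apply: deg_sum => j _.
    have [->|/gaP[_ le _]] := eqVneq (ga j) 0; first by rewrite sc0l; apply: deg0.
    by apply: deg_sc; apply: deg_iter_sh; rewrite subnKC.
  - by move=> i; case: eqP.
  - by move=> i; case: eqP => [->|//]; have [h1 h2 h3] := bnd i1; split=> //; lia.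
  move=> U U0 UD Usc Ush Ug; apply: gen => // i.
  have Uit k x : U x -> U (iter k sh x) by move=> Ux; elim: k => //= k; apply: Ush.
  have [->|ni] := eqVneq i i1; last by have := Ug i; rewrite (negbTE ni).
  have -> : g i1 = sc (ga i1)^-1
      (g1 - \sum_(j | j != i1) sc (ga j) (iter (a j - a i1) sh (g j))).
    by rewrite /g1 (bigD1 i1) //= subnn addrK scM mulVf // sc1.
  apply: (Usc); apply: (UD); first by have := Ug i1; rewrite eqxx.
  rewrite -scN1; apply: (Usc); apply: (big_ind U) => // j nj.
  by apply: (Usc); apply: (Uit); have := Ug j; rewrite (negbTE nj).
rewrite (bigD1 i1) //= eqxx [ltnRHS](bigD1 i1) //= -addSn leq_add //.
by rewrite leq_eqVlt; apply/orP; left; apply/eqP; apply: eq_bigr => i /negbTE ->.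
Qed.

Lemma family_independent d g : family d g ->
  exists d' g', family d' g' /\ independent d' g'.
Proof.
have [n] := ubnP (\sum_i d i); elim: n => // n IH in d g *; rewrite ltnS => le fam.
have [ind|nind] := pselect (independent d g); first by exists d, g.
have [d' [g' [fam' lt]]] := family_exchange fam nind.
exact: IH (leq_trans lt le) fam'.
Qed.

Lemma isum_family d g (r : seq I) : family d g -> uniq r ->
  let s := [seq ((a i - d i)%N, a i) | i <- r] in
  let comb (c : I -> nat -> K) := \sum_(i <- r) \sum_(j < d i) sc (c i j) (iter j sh (g i)) in
  exists h : {linear isum s -> X},
    (forall y, exists2 c, h y = comb c &
       (forall i j, i \in r -> (j < d i)%N -> c i j = 0) -> y = 0) /\
    (forall c, exists y, h y = comb c).
Proof.
move=> fam; elim: r => [_ s comb|i r IH /= /andP[ir ur]].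
  exists (\0 : {linear _ -> _}); split=> [y|c]; last by exists 0; rewrite linear0 /comb big_nil.
  exists (fun _ _ => 0); first by rewrite /comb big_nil.
  move=> _; have [c ->] := @imod_span K m l 0 0 (leqnn _) (leq0n _) (leq0n _) y.
  by rewrite big_ord0.
have [h [h1 h2]] := IH ur; have [da am dl] := fam_bounds fam i.
have subE : (a i - (a i - d i) = d i)%N by lia.
have [k kE] : exists k : {linear imod (a i - d i) (a i) -> X}, k (igen _ _) = g i.
  by apply: imod_hom; rewrite ?subE; [lia|lia|lia|exact: (fam_deg fam)|exact: (fam_nil fam)].
have kc (c : nat -> K) : k (\sum_(j < a i - (a i - d i)) sc (c j) (iter j sh (igen _ _))) =
    \sum_(j < d i) sc (c j) (iter j sh (g i)).
  by rewrite linear_sum subE; apply: eq_bigr => j _; rewrite sc_linear iter_sh_linear kE.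
exists ((k \o fst) \+ (h \o snd) : {linear _ -> _}); split=> [[y z]|c] /=.
  have [|||c cE] := @imod_span K m l (a i - d i) (a i) _ _ _ y; try lia.
  have [c' c'E c'0] := h1 z.
  exists (fun i' j => if i' == i then c j else c' i' j).
    rewrite big_cons eqxx {1}cE kc c'E; congr (_ + _).
    rewrite big_seq [RHS]big_seq; apply: eq_bigr => i' i'r.
    by case: eqP => // e; rewrite -e i'r in ir.
  move=> z0; congr pair.
    rewrite cE big1 // => j _; have := z0 i j; rewrite eqxx => -> //; rewrite ?sc0l ?mem_head //.
    by have := ltn_ord j; lia.
  apply: c'0 => i' j i'r lt; have := z0 i' j; rewrite inE i'r orbT => /(_ isT lt).
  by case: eqP => // e; rewrite -e i'r in ir.
have [z zE] := h2 c.
exists (\sum_(j < a i - (a i - d i)) sc (c i j) (iter j sh (igen _ _)), z).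
by rewrite big_cons kc zE.
Qed.

End Families.

Lemma fin_gen_family (X : rmodType L) : fin_gen X ->
  exists (k : nat) (g : 'I_k * 'I_m.+1 -> X),
    family (fun ip : 'I_k * 'I_m.+1 => ip.2 : nat) (fun ip => minn l ip.2) g.
Proof.
move=> [k [x xP]]; exists k, (fun ip : 'I_k * 'I_m.+1 => pr ip.2 (x ip.1)); split.
- by move=> ip; apply: deg_pr.
- move=> [i p] /=; rewrite /minn; case: ifP => _; first exact: sh_nil.
  exact: (iter_sh_deg (deg_pr _ _)).
- by move=> [i p] /=; have := ltn_ord p; split; lia.
move=> U U0 UD Usc Ush Ug y; have [c ->] := xP y.
apply: (big_ind U) => // i _; have [e ->] := Lambda_spanE (c i).
apply: (big_ind U) => // p _; apply: (big_ind U) => // j _; apply: (Usc).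
by elim: (j : nat) => [|n IH]; [apply: (Ug (i, p)) | apply: Ush].
Qed.

Lemma bijective_of (X Y : Type) (h : X -> Y) :
  injective h -> (forall y, exists x, h x = y) -> bijective h.
Proof.
move=> hi hs; have [f fK] := choice hs; exists f => // x.
by apply: hi; rewrite fK.
Qed.

Theorem decomposition (X : rmodType L) : fin_gen X ->
  exists2 s, all interval s & isomorphic (isum s) X.
Proof.
move=> /fin_gen_family[k [g0 fam0]].
have [d [g [fam ind]]] := family_independent fam0.
(* Generators whose bound has dropped to 0 are zero and would give empty intervals. *)
pose r := [seq i <- enum {: 'I_k * 'I_m.+1} | (0 < d i)%N].
have ur : uniq r by rewrite filter_uniq // enum_uniq.
have [h [h1 h2]] := isum_family fam ur.
have combE (c : 'I_k * 'I_m.+1 -> nat -> K) :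
    \sum_(i <- r) \sum_(j < d i) sc (c i j) (iter j sh (g i)) = combination d g c.
  rewrite big_filter /combination big_enum_cond /= [RHS](bigID (fun i => 0 < d i)%N) /=.
  rewrite [X in _ = _ + X]big1 ?addr0 // => i; rewrite -eqn0Ngt => /eqP ->.
  by rewrite big_ord0.
exists [seq ((ip.2 - d ip)%N, ip.2 : nat) | ip : 'I_k * 'I_m.+1 <- r].
  rewrite all_map; apply/allP => ip; rewrite mem_filter => /andP[d0 _] /=.
  by have [h3 h4 h5] := fam_bounds fam ip; rewrite /interval /=; lia.
exists h; apply: bijective_of => [x y e|x].
  apply/eqP; rewrite -subr_eq0; apply/eqP.
  have [c cE] := h1 (x - y); apply => i j _ lt; apply: (ind c) lt.
  by rewrite -combE -cE linearB e subrr.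
have [c ->] := family_span fam x.
by have [y yE] := h2 c; exists y; rewrite yE combE.
Qed.

End Decomposition.

(** * Finite generation and approximations under isomorphisms and products *)

Section Generalities.
Local Open Scope ring_scope.
Variable A : pzRingType.
Implicit Types X Y M N : rmodType A.

Lemma isomorphic_sym X Y : isomorphic X Y -> isomorphic Y X.
Proof. by move=> [u /isomorphic_inv[v [uK vK]]]; exists v, u. Qed.

Lemma fin_gen_surj X Y (f : {linear X -> Y}) : surjective f -> fin_gen X -> fin_gen Y.
Proof.
move=> fs [k [g gP]]; exists k, (f \o g) => y; have [x <-] := fs y.
have [c ->] := gP x; exists c.
by rewrite linear_sum; apply: eq_bigr => i _; rewrite linearZ.
Qed.

Lemma fin_gen_iso X Y : isomorphic X Y -> fin_gen X -> fin_gen Y.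
Proof. by move=> [u [v _ vK]]; apply: (@fin_gen_surj _ _ u) => y; exists (v y). Qed.

Lemma fin_gen_prod X Y : fin_gen X -> fin_gen Y -> fin_gen (X * Y)%type.
Proof.
move=> [k [g gP]] [k' [g' g'P]].
exists (k + k')%N, (fun i => match split i with inl j => (g j, 0) | inr j => (0, g' j) end).
move=> [x y]; have [c ->] := gP x; have [c' ->] := g'P y.
exists (fun i => match split i with inl j => c j | inr j => c' j end).
rewrite big_split_ord /= [LHS](pairE (_, _)) /=; congr (_ + _).
  rewrite linear_sum; apply: eq_bigr => i _.
  by rewrite (unsplitK (inl i)) linearZ.
rewrite linear_sum; apply: eq_bigr => i _.
by rewrite (unsplitK (inr i)) linearZ.
Qed.

Section Approximations.
Variable C : rmodType A -> Prop.
Hypothesis C_prod : forall X Y, C X -> C Y -> C (X * Y)%type.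

Definition has_approximations M :=
  (exists X (f : {linear M -> X}), left_approximation C f) /\
  (exists X (f : {linear X -> M}), right_approximation C f).

Lemma has_approximations_prod M N :
  has_approximations M -> has_approximations N -> has_approximations (M * N)%type.
Proof.
move=> [[X [f [CX fX]]] [Y [g [CY gY]]]] [[X' [f' [CX' fX']]] [Y' [g' [CY' gY']]]].
split.
  exists (X * X')%type, (pair_fun f f'); split=> [|Z k CZ]; first exact: C_prod.
  have [h hE] := fX Z (k \o @inl_fun _ _ _ : {linear _ -> _}) CZ.
  have [h' h'E] := fX' Z (k \o @inr_fun _ _ _ : {linear _ -> _}) CZ.
  exists ((h \o fst) \+ (h' \o snd) : {linear _ -> _}) => x.
  by rewrite [in RHS](pairE x) linearD /= hE h'E.
exists (Y * Y')%type, (pair_fun g g'); split=> [|Z k CZ]; first exact: C_prod.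
have [h hE] := gY Z (fst \o k : {linear _ -> _}) CZ.
have [h' h'E] := gY' Z (snd \o k : {linear _ -> _}) CZ.
exists ((@inl_fun _ _ _ \o h) \+ (@inr_fun _ _ _ \o h') : {linear _ -> _}) => x.
by rewrite /= inl_inrE /pair_fun /= hE h'E /=; case: (k x).
Qed.

Lemma has_approximations_iso M N : isomorphic M N ->
  has_approximations M -> has_approximations N.
Proof.
move=> [u /isomorphic_inv[v [uK vK]]] [[X [f [CX fX]]] [Y [g [CY gY]]]]; split.
  exists X, (f \o v : {linear _ -> _}); split=> // Z k CZ.
  have [h hE] := fX Z (k \o u : {linear _ -> _}) CZ.
  by exists h => x; rewrite /= hE /= vK.
exists Y, (u \o g : {linear _ -> _}); split=> // Z k CZ.
have [h hE] := gY Z (v \o k : {linear _ -> _}) CZ.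
by exists h => x; rewrite /= hE /= vK.
Qed.

End Approximations.
End Generalities.

(* [ext_nonzero l i p q]: Ext^i(imod p, imod q) is nonzero, for [i > 0]. *)
Definition ext_nonzero (l i : nat) (p q : nat * nat) : bool :=
  [&& syz l p.1 p.2 i.+1 <= q.1, q.1 < syz l p.1 p.2 i, syz l p.1 p.2 i <= q.2
    & q.2 < syz l p.1 p.2 i.-1].

(** * Ext and Hom for direct sums of interval modules *)

Section IntervalSums.
Local Open Scope ring_scope.
Variables (K : fieldType) (m l : nat).
Local Notation L := (Lambda K m l).
Local Notation imod := (imod K m l).
Local Notation igen := (igen K m l).
Local Notation isum := (isum K m l).
Local Notation interval := (interval m l).

(** Exactness fails exactly when degree [q] carries a basis vector that dies on the way to degree
    [r] while degree [p] lies above the interval, so that nothing maps onto the vector. *)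
Lemma exact_at_imod b a p q r : (b <= a)%N -> (a <= m)%N -> (a - b <= l)%N ->
  (r <= q <= p)%N ->
  exact_at (imod b a) p q r <-> ~~ [&& r <= b, b < q, q <= a & a < p]%N.
Proof.
move=> ba am abl /andP[rq qp]; split=> [ex|].
  apply/negP => /and4P[rb bq qa ap].
  have [||z dz zE] := ex (iter (a - q) sh (igen b a)).
  - by apply: deg_iter_sh; rewrite subnKC //; apply: deg_igen.
  - rewrite -iterD; apply: (@iter_sh_ge _ _ _ _ (a - b)); first lia.
    by apply: iter_sh_igen0.
  have z0 : z = 0.
    by have := imod_degE ba am abl dz; rewrite (leqNgt p) ap andbF.
  have := @imod_free1 K m l b a 1 (a - q) ba am abl.
  rewrite -zE z0 iter_sh0 sc0 => /(_ _ erefl) e.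
  by have /eqP := e ltac:(lia); rewrite oner_eq0.
move=> n y dy y0; have := imod_degE ba am abl dy.
case: ifP => [/andP[bq qa] [c e]|_ ->]; last first.
  by exists 0; [apply: deg0 | rewrite iter_sh0].
have [pa|ap] := leqP p a.
  exists (sc c (iter (a - p) sh (igen b a))).
    by apply: deg_sc; apply: deg_iter_sh; rewrite subnKC //; apply: deg_igen.
  rewrite iter_sh_sc -iterD e; congr (sc _ (iter _ _ _)); lia.
have c0 : c = 0.
  apply: (@imod_free1 K m l b a c (a - r)) => //; first by move: n; lia.
  rewrite -y0 e iter_sh_sc -iterD; congr (sc _ (iter _ _ _)); lia.
by exists 0; [apply: deg0 | rewrite iter_sh0 e c0 sc0l].
Qed.

Lemma exact_at_prod (X Y : rmodType L) p q r :
  exact_at (X * Y)%type p q r <-> exact_at X p q r /\ exact_at Y p q r.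
Proof.
split=> [ex|[eX eY] z dz z0].
  split=> y dy y0.
    have [||z dz zE] := ex (inl_fun Y y); first exact: deg_linear.
      by rewrite -iter_sh_linear y0 linear0.
    exists z.1; first exact: (deg_linear fst).
    by rewrite -(iter_sh_linear fst) zE.
  have [||z dz zE] := ex (inr_fun X y); first exact: deg_linear.
    by rewrite -iter_sh_linear y0 linear0.
  exists z.2; first exact: (deg_linear snd).
  by rewrite -(iter_sh_linear snd) zE.
have [||x dx xE] := eX z.1; first exact: (deg_linear fst).
  by rewrite -(iter_sh_linear fst) z0.
have [||y dy yE] := eY z.2; first exact: (deg_linear snd).
  by rewrite -(iter_sh_linear snd) z0.
exists (inl_fun Y x + inr_fun X y); first by apply: degD; apply: deg_linear.
by rewrite iter_shD -!iter_sh_linear xE yE -pairE.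
Qed.

Lemma exact_at_iso (X Y : rmodType L) p q r : isomorphic X Y ->
  exact_at X p q r -> exact_at Y p q r.
Proof.
move=> [u /isomorphic_inv[v [uK vK]]] ex y dy y0.
have [||z dz zE] := ex (v y); first exact: deg_linear.
  by rewrite -iter_sh_linear y0 linear0.
by exists (u z); [apply: deg_linear | rewrite -iter_sh_linear zE vK].
Qed.

Lemma exact_at_isum s p q r : (r <= q <= p)%N ->
  exact_at (isum s) p q r <-> forall ba, ba \in s -> exact_at (imod ba.1 ba.2) p q r.
Proof.
move=> rqp; elim: s => [|[b a] s IH] /=.
  by split=> // _; apply/exact_at_imod => //; lia.
rewrite exact_at_prod IH; split=> [[h1 h2] ba|h]; last first.
  split; first by apply: (h (b, a)); rewrite mem_head.
  by move=> ba bas; apply: h; rewrite inE bas orbT.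
by rewrite inE => /orP[/eqP -> //|]; apply: h2.
Qed.

Lemma fin_gen_imod b a : (b <= a)%N -> (a <= m)%N -> (a - b <= l)%N -> fin_gen (imod b a).
Proof.
move=> ba am abl; exists 1%N, (fun=> igen b a) => w.
have [c ->] := imod_span ba am abl w.
exists (fun=> \sum_(j < a - b)
   (to_Lambda l (scalar_path m (c j)) : L^c) * (to_Lambda l (arrows K m ^+ j) : L^c)).
rewrite big_ord1 scaler_suml; apply: eq_bigr => j _.
by rewrite iter_shE -scalerA.
Qed.

Lemma fin_gen_isum s : all interval s -> fin_gen (isum s).
Proof.
elim: s => [_|[b a] s IH /andP[/and3P[/= ba am abl] /IH fs]]; first exact: fin_gen_imod.
by apply: fin_gen_prod => //; apply: fin_gen_imod => //; apply: ltnW.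
Qed.

Lemma Ext_zero_isum s (N : rmodType L) i : all interval s ->
  Ext_zero i.+1 (isum s) N <-> forall ba, ba \in s -> Ext_zero i.+1 (imod ba.1 ba.2) N.
Proof.
move=> sI.
(* A resolution of the sum is carried through the induction, since [Ext_zero_prod] takes one of each
   factor. *)
suff [P H] : exists P : proj_resolution (isum s),
   Ext_zero i.+1 (isum s) N <-> forall ba, ba \in s -> Ext_zero i.+1 (imod ba.1 ba.2) N by [].
elim: s sI => [_|[b a] s IH /andP[/and3P[/= ba am abl] /IH[P PE]]].
  exists (imod_resolution K (leqnn 0) (leq0n m) (leq0n l)); split=> // _.
  apply/Ext_zero_imod => // y; have -> : syz l 0 0 i.+1 = 0%N.
    by apply/eqP; rewrite -leqn0 syz_max.
  by rewrite /deg pr0_eq0 => <- _; exists 0; [apply: deg0 | rewrite iter_sh0].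
pose P' := imod_resolution K (ltnW ba) am abl.
exists (prod_resolution P' P); rewrite /= (Ext_zero_prod P' P) PE; split=> [[h1 h2] p|h].
  by rewrite inE => /orP[/eqP -> //|]; apply: h2.
split; first by apply: (h (b, a)); rewrite mem_head.
by move=> p ps; apply: h; rewrite inE ps orbT.
Qed.

Lemma Ext_zero_imod_imod p q i : interval p -> interval q ->
  Ext_zero i.+1 (imod p.1 p.2) (imod q.1 q.2) <-> ~~ ext_nonzero l i.+1 p q.
Proof.
move=> /and3P[p1 p2 p3] /and3P[q1 q2 q3].
rewrite Ext_zero_imod ?(ltnW p1) // exact_at_imod ?(ltnW q1) //.
have [le1 _] := syz_le i (ltnW p1) p3; have [le2 _] := syz_le i.+1 (ltnW p1) p3.
by rewrite le1 le2.
Qed.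

Lemma sc_is_linear (X : rmodType L) c : linear (sc c : X -> X).
Proof.
apply: linear_criterion => [x y|d x|p x|x].
- exact: scD.
- by rewrite !scM mulrC.
- by rewrite pr_sc.
- by rewrite sh_sc.
Qed.

HB.instance Definition _ (X : rmodType L) c :=
  GRing.isLinear.Build L^c X X _ (@sc K m l X c) (sc_is_linear c).

(** Hom between interval modules is at most one-dimensional, so a single map per interval is enough
    for approximations. *)
Lemma imod_hom_line p q : interval p -> interval q ->
  exists h0 : {linear imod p.1 p.2 -> imod q.1 q.2},
    forall h : {linear imod p.1 p.2 -> imod q.1 q.2}, exists c, forall x, h x = sc c (h0 x).
Proof.
move: p q => [b a] [b' a'] /and3P[/= p1 p2 p3] /and3P[/= q1 q2 q3].
have ext (h h' : {linear imod b a -> imod b' a'}) c :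
    h (igen b a) = sc c (h' (igen b a)) -> forall x, h x = sc c (h' x).
  move=> e; apply: (@imod_hom_ext _ _ _ _ _ _ _ _ _ h (sc c \o h' : {linear _ -> _})) => //.
  exact: ltnW.
have [[h0 nz]|Z] := pselect (exists h : {linear imod b a -> imod b' a'},
  h (igen b a) <> 0); last first.
  exists (\0 : {linear _ -> _}) => h; exists 0; apply: ext; rewrite sc0l.
  by apply: contrapT => nh; apply: Z; exists h.
exists h0 => h.
have D (k : {linear imod b a -> imod b' a'}) :=
  imod_degE (ltnW q1) q2 q3 (deg_linear k (deg_igen K m l b a)).
move: (D h0) (D h); case: ifP => // _ [c0 e0] [c e].
exists (c / c0); apply: ext; rewrite e e0 scM mulfVK //.
by apply/eqP => c00; apply: nz; rewrite e0 c00 sc0l.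
Qed.

Lemma isum_copair s (N : rmodType L) (h0 : forall p, {linear imod p.1 p.2 -> N}) :
  exists f : {linear isum s -> N}, forall p, p \in s ->
    exists k : {linear imod p.1 p.2 -> isum s}, forall x, f (k x) = h0 p x.
Proof.
elim: s => [|[b a] s [f fP]] /=; first by exists (\0 : {linear _ -> _}).
exists ((h0 (b, a) \o fst) \+ (f \o snd) : {linear _ -> _}) => p.
rewrite inE => /orP[/eqP ->|/fP[k kE]].
  by exists (@inl_fun _ _ _ : {linear _ -> _}) => x; rewrite /= linear0 addr0.
by exists (@inr_fun _ _ _ \o k : {linear _ -> _}) => x; rewrite /= linear0 add0r.
Qed.

Lemma isum_pair s (N : rmodType L) (h0 : forall p, {linear N -> imod p.1 p.2}) :
  exists f : {linear N -> isum s}, forall p, p \in s ->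
    exists k : {linear isum s -> imod p.1 p.2}, forall x, k (f x) = h0 p x.
Proof.
elim: s => [|[b a] s [f fP]] /=; first by exists (\0 : {linear _ -> _}).
exists ((@inl_fun _ _ _ \o h0 (b, a)) \+ (@inr_fun _ _ _ \o f) : {linear _ -> _}) => p.
rewrite inE => /orP[/eqP ->|/fP[k kE]].
  by exists (fst : {linear _ -> _}) => x; rewrite [LHS](congr1 fst (inl_inrE _ _)).
by exists (k \o snd : {linear _ -> _}) => x; rewrite [LHS](congr1 (k \o snd) (inl_inrE _ _)) /=.
Qed.

Lemma isum_nil0 (x : isum [::]) : x = 0.
Proof. by have [c ->] := @imod_span K m l 0 0 isT isT isT x; rewrite big_ord0. Qed.

Lemma isum_lift s (X N : rmodType L) (f : {linear X -> N}) :
  (forall p, p \in s -> forall g : {linear imod p.1 p.2 -> N},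
     exists h : {linear imod p.1 p.2 -> X}, forall x, f (h x) = g x) ->
  forall g : {linear isum s -> N}, exists h : {linear isum s -> X}, forall x, f (h x) = g x.
Proof.
elim: s => [_ g|[b a] s IH H g].
  by exists (\0 : {linear _ -> _}) => x; rewrite (isum_nil0 x) !linear0.
have [h hE] := H (b, a) (mem_head _ _) (g \o @inl_fun _ _ _ : {linear _ -> _}).
have [|k kE] := IH _ (g \o @inr_fun _ _ _ : {linear _ -> _}).
  by move=> p ps; apply: H; rewrite inE ps orbT.
exists ((h \o fst) \+ (k \o snd) : {linear _ -> _}) => x.
by rewrite [in RHS](pairE x) !linearD /= hE kE.
Qed.

Lemma isum_colift s (X N : rmodType L) (f : {linear N -> X}) :
  (forall p, p \in s -> forall g : {linear N -> imod p.1 p.2},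
     exists h : {linear X -> imod p.1 p.2}, forall x, h (f x) = g x) ->
  forall g : {linear N -> isum s}, exists h : {linear X -> isum s}, forall x, h (f x) = g x.
Proof.
elim: s => [_ g|[b a] s IH H g].
  by exists (\0 : {linear _ -> _}) => x; rewrite (isum_nil0 (g x)).
have [h hE] := H (b, a) (mem_head _ _) (fst \o g : {linear _ -> _}).
have [|k kE] := IH _ (snd \o g : {linear _ -> _}).
  by move=> p ps; apply: H; rewrite inE ps orbT.
exists ((@inl_fun _ _ _ \o h) \+ (@inr_fun _ _ _ \o k) : {linear _ -> _}) => x.
by rewrite /= inl_inrE hE kE /=; case: (g x).
Qed.

End IntervalSums.

(** * Reduction to sets of intervals *)

Record interval_tilting (m l n : nat) (S : nat * nat -> Prop) : Prop := IntervalTilting {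
  it_interval : forall p, S p -> interval m l p;
  it_rigid : forall p q i, S p -> S q -> 0 < i < n -> ~~ ext_nonzero l i p q;
  it_right : forall p, interval m l p ->
    (forall q i, S q -> 0 < i < n -> ~~ ext_nonzero l i q p) -> S p;
  it_left : forall p, interval m l p ->
    (forall q i, S q -> 0 < i < n -> ~~ ext_nonzero l i p q) -> S p }.

Lemma dependent_choice (T : Type) (U : T -> Type) (P : forall t, U t -> Prop) :
  (forall t, exists u, P t u) -> exists f, forall t, P t (f t).
Proof. by move=> H; exists (fun t => sval (cid (H t))) => t; apply: svalP. Qed.

Section Reduction.
Local Open Scope ring_scope.
Variables (K : fieldType) (m l n : nat).
Local Notation L := (Lambda K m l).
Local Notation imod := (imod K m l).
Local Notation isum := (isum K m l).
Local Notation interval := (interval m l).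

Section ToIntervals.
Variable C : rmodType L -> Prop.
Hypothesis ctC : cluster_tilting C n.

Lemma ct_iso (X Y : rmodType L) : isomorphic X Y -> C Y -> C X.
Proof.
move=> [u [v uK vK]] CY; apply: (ct_summand ctC (Y := isum [::]) CY).
exists (u \o fst : {linear _ -> _}); exists (fun y => (v y, 0)) => [[x z]|y] /=.
  by rewrite uK (isum_nil0 z).
exact: vK.
Qed.

Lemma ct_isum s : C (isum s) -> forall p, p \in s -> C (imod p.1 p.2).
Proof.
elim: s => // -[b a] s IH Cs p; rewrite inE => /orP[/eqP ->|ps] /=.
  by apply: (ct_summand ctC Cs); exists (idfun : {linear _ -> _}); exists idfun.
apply: IH ps; apply: (ct_summand ctC (Y := imod b a) Cs).
exists ((@inl_fun _ _ _ \o snd) \+ (@inr_fun _ _ _ \o fst) : {linear _ -> _}).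
exists (fun z => (z.2, z.1)) => -[x y]; last exact: inl_inrE.
exact: (congr1 (fun z => (z.2, z.1)) (inl_inrE y x)).
Qed.

Lemma ct_decomposition X : C X -> exists s, [/\ all interval s, isomorphic (isum s) X &
  forall p, p \in s -> C (imod p.1 p.2)].
Proof.
move=> CX; have [s sI sX] := decomposition (ct_fin_gen ctC CX).
by exists s; split=> //; apply: ct_isum; apply: ct_iso sX CX.
Qed.

Lemma interval_fin_gen p : interval p -> fin_gen (imod p.1 p.2).
Proof. by move=> /and3P[p1 p2 p3]; apply: fin_gen_imod => //; apply: ltnW. Qed.

Lemma Ext_zero_imod_iso p X Y i : interval p -> isomorphic X Y ->
  Ext_zero i.+1 (imod p.1 p.2) X -> Ext_zero i.+1 (imod p.1 p.2) Y.
Proof.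
move=> /and3P[p1 p2 p3] XY; rewrite !Ext_zero_imod ?(ltnW p1) //.
exact: exact_at_iso.
Qed.

Lemma Ext_zero_imod_isum p s i : interval p -> all interval s ->
  (forall q, q \in s -> ~~ ext_nonzero l i.+1 p q) -> Ext_zero i.+1 (imod p.1 p.2) (isum s).
Proof.
move=> pI sI H; have /and3P[p1 p2 p3] := pI.
rewrite Ext_zero_imod ?(ltnW p1) // exact_at_isum; last first.
  have [le1 _] := syz_le i (ltnW p1) p3; have [le2 _] := syz_le i.+1 (ltnW p1) p3.
  by rewrite le1 le2.
move=> q qs; rewrite -Ext_zero_imod ?(ltnW p1) //.
by apply/Ext_zero_imod_imod => //; [apply: (allP sI) | apply: H].
Qed.

Lemma ct_interval_tilting :
  interval_tilting m l n (fun p => interval p /\ C (imod p.1 p.2)).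
Proof.
split.
- by move=> p [].
- move=> p q [//|i] [pI Cp] [qI Cq] lt.
  apply/(Ext_zero_imod_imod K i pI qI).
  by have [/(ct_right ctC)[_ H] _] := conj Cq I; apply: H lt Cp.
- move=> p pI H; split=> //; apply/(ct_right ctC); split; first exact: interval_fin_gen.
  move=> [//|i] Y lt CY; have [s [sI sY sC]] := ct_decomposition CY.
  apply: Ext_zero_iso sY _; apply/Ext_zero_isum => // q qs.
  have qI := allP sI q qs.
  by apply/Ext_zero_imod_imod => //; apply: H => //; split=> //; apply: sC.
- move=> p pI H; split=> //; apply/(ct_left ctC); split; first exact: interval_fin_gen.
  move=> [//|i] Y lt CY; have [s [sI sY sC]] := ct_decomposition CY.
  apply: (Ext_zero_imod_iso pI sY); apply: Ext_zero_imod_isum => // q qs.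
  by apply: H => //; split; [apply: (allP sI) | apply: sC].
Qed.

End ToIntervals.

Section FromIntervals.
Variable S : nat * nat -> Prop.
Hypothesis tS : interval_tilting m l n S.

(** The candidate subcategory. With orthogonality as the definition, rather than sums of intervals
    from [S], closure under isomorphism and summands needs no uniqueness of decompositions;
    [Ext_perp_decomposition] recovers the sums. *)
Definition Ext_perp (X : rmodType L) : Prop := fin_gen X /\
  forall p i, S p -> (0 < i.+1 < n)%N -> Ext_zero i.+1 (imod p.1 p.2) X.

Lemma Ext_perp_iso X Y : isomorphic X Y -> Ext_perp X -> Ext_perp Y.
Proof.
move=> XY [fX H]; split; first exact: fin_gen_iso XY fX.
move=> p i Sp lt; apply: Ext_zero_imod_iso XY (H _ _ Sp lt).
exact: it_interval tS _ Sp.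
Qed.

Lemma Ext_perp_prod (X Y : rmodType L) : Ext_perp X -> Ext_perp Y -> Ext_perp (X * Y)%type.
Proof.
move=> [fX HX] [fY HY]; split; first exact: fin_gen_prod.
move=> p i Sp lt; have /and3P[p1 p2 p3] := it_interval tS Sp.
have := HX p i Sp lt; have := HY p i Sp lt.
by rewrite !Ext_zero_imod ?(ltnW p1) // exact_at_prod.
Qed.

Lemma Ext_perp_summand (X Y : rmodType L) : Ext_perp (X * Y)%type -> Ext_perp X.
Proof.
move=> [fXY H]; split.
  by apply: (@fin_gen_surj _ _ _ (fst : {linear (X * Y)%type -> X})) fXY => x; exists (x, 0).
move=> p i Sp lt; have /and3P[p1 p2 p3] := it_interval tS Sp.
by have := H p i Sp lt; rewrite !Ext_zero_imod ?(ltnW p1) // exact_at_prod => -[].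
Qed.

Lemma Ext_perp_isum s : all interval s -> (forall p, p \in s -> S p) -> Ext_perp (isum s).
Proof.
move=> sI sS; split; first exact: fin_gen_isum.
move=> p i Sp lt; apply: Ext_zero_imod_isum => //; first exact: it_interval tS _ Sp.
by move=> q /sS Sq; apply: (it_rigid tS).
Qed.

Lemma Ext_perp_isumP s : all interval s -> Ext_perp (isum s) -> forall p, p \in s -> S p.
Proof.
move=> sI [_ H] p ps; have pI := allP sI p ps; apply: (it_right tS pI) => q [//|i] Sq lt.
have qI := it_interval tS Sq; apply/(Ext_zero_imod_imod K i qI pI).
have /and3P[q1 q2 q3] := qI; have := H q i Sq lt.
rewrite !Ext_zero_imod ?(ltnW q1) // exact_at_isum; first by apply.
have [le1 _] := syz_le i (ltnW q1) q3; have [le2 _] := syz_le i.+1 (ltnW q1) q3.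
by rewrite le1 le2.
Qed.

Lemma Ext_perp_decomposition X : Ext_perp X ->
  exists s, [/\ all interval s, isomorphic (isum s) X & forall p, p \in s -> S p].
Proof.
move=> PX; have [s sI sX] := decomposition PX.1; exists s; split=> //.
by apply: Ext_perp_isumP => //; apply: Ext_perp_iso (isomorphic_sym sX) PX.
Qed.

Lemma Ext_perp_Ext_zero X Y i : (0 < i < n)%N -> Ext_perp X -> Ext_perp Y -> Ext_zero i X Y.
Proof.
case: i => // i lt PX PY; have [s [sI sX sS]] := Ext_perp_decomposition PX.
apply: Ext_zero_iso sX _; apply/Ext_zero_isum => // p ps.
by case: PY => _; apply => //; apply: sS.
Qed.

Lemma Ext_perp_imod p : S p -> Ext_perp (imod p.1 p.2).
Proof.
move=> Sp; have pI := it_interval tS Sp; split; first exact: interval_fin_gen.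
move=> q i Sq lt; apply/Ext_zero_imod_imod => //; first exact: it_interval tS _ Sq.
exact: (it_rigid tS).
Qed.

Lemma interval_list : exists s, [/\ all interval s, forall p, p \in s -> S p
  & forall p, S p -> p \in s].
Proof.
exists [seq p <- [seq (b, a) | b <- iota 0 m.+1, a <- iota 0 m.+1] | `[< S p >]].
split.
- by apply/allP => p; rewrite mem_filter => /andP[/asboolP/(it_interval tS)].
- by move=> p; rewrite mem_filter => /andP[/asboolP].
move=> [b a] Sp; rewrite mem_filter; apply/andP; split; first exact/asboolP.
have /and3P[] := it_interval tS Sp; rewrite [(b, a).1]/= [(b, a).2]/= => ba am _.
by apply/allpairsP; exists (b, a); rewrite !mem_iota; split=> //=; lia.
Qed.

(** [S] is finite, and the approximating object is the sum of its intervals. Any map between [q] and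
    an interval of [S] is a scalar multiple of the chosen one, hence factors through the sum. *)
Lemma imod_approximations q : interval q -> has_approximations Ext_perp (imod q.1 q.2).
Proof.
move=> qI; have [s [sI sS Ss]] := interval_list; split.
  have H0 p : exists h0 : {linear imod q.1 q.2 -> imod p.1 p.2}, interval p ->
      forall h : {linear imod q.1 q.2 -> imod p.1 p.2}, exists c, forall x, h x = sc c (h0 x).
    have [pI|nI] := boolP (interval p); last by exists (\0 : {linear _ -> _}).
    by have [h0 h0E] := imod_hom_line K qI pI; exists h0.
  have [h0 h0E] := dependent_choice H0.
  have [f fP] := isum_pair s h0.
  exists (isum s), f; split=> [|Y g PY]; first exact: Ext_perp_isum.
  have [t [tI [u /isomorphic_inv[v [uK vK]]] tS']] := Ext_perp_decomposition PY.
  have [p pt g'|k kE] := @isum_colift _ _ _ t _ _ f _ (v \o g : {linear _ -> _}).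
    have [k kE] := fP p (Ss p (tS' p pt)).
    have [c cE] := h0E p (allP tI p pt) g'.
    exists (sc c \o k : {linear _ -> _}) => x.
    by rewrite /= kE cE.
  by exists (u \o k : {linear _ -> _}) => x; rewrite /= kE /= vK.
have H0 p : exists h0 : {linear imod p.1 p.2 -> imod q.1 q.2}, interval p ->
    forall h : {linear imod p.1 p.2 -> imod q.1 q.2}, exists c, forall x, h x = sc c (h0 x).
  have [pI|nI] := boolP (interval p); last by exists (\0 : {linear _ -> _}).
  by have [h0 h0E] := imod_hom_line K pI qI; exists h0.
have [h0 h0E] := dependent_choice H0.
have [f fP] := isum_copair s h0.
exists (isum s), f; split=> [|Y g PY]; first exact: Ext_perp_isum.
have [t [tI [u /isomorphic_inv[v [uK vK]]] tS']] := Ext_perp_decomposition PY.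
have [p pt g'|k kE] := @isum_lift _ _ _ t _ _ f _ (g \o u : {linear _ -> _}).
  have [k kE] := fP p (Ss p (tS' p pt)).
  have [c cE] := h0E p (allP tI p pt) g'.
  exists (k \o sc c : {linear _ -> _}) => x.
  by rewrite /= kE cE sc_linear.
by exists (k \o v : {linear _ -> _}) => x; rewrite /= kE /= vK.
Qed.

Lemma interval_tilting_ct : cluster_tilting Ext_perp n.
Proof.
have Sfg X : Ext_perp X -> fin_gen X by case.
split=> //.
- exact: Ext_perp_prod.
- move=> X Y Z PZ XYZ; apply: (@Ext_perp_summand X Y).
  exact: Ext_perp_iso (isomorphic_sym XYZ) PZ.
- move=> M fM; have [s sI sM] := decomposition fM.
  apply: has_approximations_iso sM _.
  elim: s sI => [_|[b a] s IH /andP[baI /IH Hs]]; last first.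
    exact: (has_approximations_prod Ext_perp_prod (imod_approximations baI) Hs).
  have P0 : Ext_perp (isum [::]) by apply: Ext_perp_isum.
  split; exists (isum [::]), (idfun : {linear _ -> _}); split=> // X g _; by exists g.
- move=> X; split=> [PX|[fX H]].
    by split=> [|i Y lt PY]; [apply: Sfg | apply: Ext_perp_Ext_zero].
  by split=> // p i Sp lt; apply: H => //; apply: Ext_perp_imod.
- move=> X; split=> [PX|[fX H]].
    by split=> [|i Y lt PY]; [apply: Sfg | apply: Ext_perp_Ext_zero].
  have [s sI sX] := decomposition fX; apply: (Ext_perp_iso sX).
  apply: Ext_perp_isum => // p ps; have pI := allP sI p ps.
  apply: (it_left tS pI) => q [//|i] Sq lt; have qI := it_interval tS Sq.
  apply/(Ext_zero_imod_imod K i pI qI).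
  have := Ext_zero_iso (isomorphic_sym sX) (H i.+1 _ lt (Ext_perp_imod Sq)).
  by move=> /(Ext_zero_isum _ _ sI); apply.
Qed.

End FromIntervals.

Theorem cluster_tilting_intervals :
  admits_cluster_tilting L n <-> exists S, interval_tilting m l n S.
Proof.
split=> [[C /ct_interval_tilting tS]|[S tS]]; first by eexists; apply: tS.
by exists (Ext_perp S); apply: interval_tilting_ct.
Qed.

End Reduction.

(** * Tilting sets of intervals *)

Lemma syz_even l b a p : syz l b a (2 * p) = a - p * l.
Proof.
elim: p => [|p IH]; first by rewrite muln0 mul0n subn0.
by rewrite mulnS syzSS IH mulSn; lia.
Qed.

Lemma syz_odd l b a p : syz l b a (2 * p).+1 = b - p * l.
Proof.
elim: p => [|p IH]; first by rewrite muln0 mul0n subn0.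
by rewrite mulnS -addnS addnC addn2 syzSS -/(syz _ _ _ _) IH mulSn; lia.
Qed.

(** Interlacing made explicit: in degree [2p + 1] the second interval, shifted up by [p l], overlaps
    the first from below; in degree [2p + 2], shifted up by [(p + 1) l], it overlaps from above.
    Truncated subtractions become additions on the other side, which keeps all conditions linear. *)
Lemma ext_odd l p b a b' a' : ext_nonzero l (2 * p).+1 (b, a) (b', a') =
  [&& a <= b' + p * l + l, b' + p * l < b, b <= a' + p * l & a' + p * l < a].
Proof.
rewrite /ext_nonzero -[(2 * p).+1.-1]/(2 * p) (_ : (2 * p).+2 = 2 * p.+1); last lia.
by rewrite syz_odd !syz_even mulSn /=; lia.
Qed.

Lemma ext_even l p b a b' a' : ext_nonzero l (2 * p).+2 (b, a) (b', a') =
  [&& b <= b' + p * l + l, b' + p * l + l < a, a <= a' + p * l + l & a' + p * l < b].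
Proof.
rewrite /ext_nonzero -[(2 * p).+2.-1]/((2 * p).+1).
by rewrite (syzSS _ _ _ (2 * p).+1) (syzSS _ _ _ (2 * p)) syz_odd syz_even /=; lia.
Qed.

Lemma ext_index i : 0 < i -> exists p, i = (2 * p).+1 \/ i = (2 * p).+2.
Proof.
move=> i0; have [o|e] := boolP (odd i).
  exists i./2; left; rewrite -{1}[i]odd_double_half o -muln2; lia.
exists i./2.-1; right; have := odd_double_half i; rewrite (negbTE e) -muln2; lia.
Qed.

Lemma syz_strict l b a i : 0 < l -> b < a -> a < b + l ->
  (0 < syz l b a i -> syz l b a i.+1 < syz l b a i) /\
  syz l b a i < syz l b a i.+1 + l.
Proof.
move=> l0 ba abl; elim: i => [|i [IH1 IH2]]; first by split=> /=; lia.
have [|le _] := @syz_le l b a i (ltnW ba); first lia.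
by rewrite syzSS; lia.
Qed.

(** * From a tilting set to the arithmetic conditions *)

Section Necessity.
Variables (m l n : nat) (S : nat * nat -> Prop).
Hypotheses (l2 : 2 <= l) (n2 : 2 <= n) (tS : interval_tilting m l n S).

(** Ext out of a projective vanishes. Truncated subtraction lets [b = a - l] cover both kinds of
    projectives, those of length [l] and those with [b = 0]; the minimum in [tilting_inj] does the
    same for injectives. *)
Lemma tilting_proj b a : interval m l (b, a) -> b = a - l -> S (b, a).
Proof.
move=> pI e; apply: (it_left tS pI) => -[b' a'] i Sq /andP[/ext_index[p []] -> _].
  by rewrite ext_odd; lia.
by rewrite ext_even; lia.
Qed.

Lemma tilting_inj b a : interval m l (b, a) -> a = minn m (b + l) -> S (b, a).
Proof.
move=> pI e; apply: (it_right tS pI) => -[b' a'] i Sq /andP[/ext_index[p ip] _].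
have /and3P[/= _ am _] := it_interval tS Sq.
case: ip => ->; first by rewrite ext_odd; lia.
by rewrite ext_even; lia.
Qed.

(* Otherwise, for the last [i] with [x = syz l b a i] positive, [x <= l] and
   there would be a nonzero Ext^i from [(b, a)] to the projective [(0, x)]. *)
Lemma tilting_syz_gt0 b a i : S (b, a) -> 0 < b -> a < b + l -> i <= n ->
  0 < syz l b a i.
Proof.
move=> Sp b0 abl; have /and3P[/= ba am _] := it_interval tS Sp.
elim: i => [|i IH] lt; first by rewrite /=; lia.
have {}IH := IH (ltnW lt).
case: i => [//|i] in lt IH *.
rewrite lt0n; apply/negP => /eqP e.
have [|_ h] := @syz_strict l b a i.+1 _ ba abl; first lia.
have [|h1 _] := @syz_strict l b a i _ ba abl; first lia.
have [|h2 _] := @syz_le l b a i (ltnW ba); first lia.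
have h3 : syz l b a i <= a by apply: syz_max; lia.
have [x xE] : exists x, syz l b a i.+1 = x by eexists.
rewrite xE in IH h h1 h2.
have Sq : S (0, x) by apply: tilting_proj; rewrite ?/interval /=; lia.
suff : ext_nonzero l i.+1 (b, a) (0, x) by apply/negP/(it_rigid tS Sp Sq); lia.
by rewrite /ext_nonzero -[i.+1.-1]/i e xE /=; lia.
Qed.

(* The new interval is the [n]-Auslander-Reiten translate
   [(syz n - 1, syz (n - 1) - 1)] of [(b, a)]: by [ext_odd] and [ext_even],
   Ext^i(q, -) is nonzero on it exactly when Ext^(n-i)((b, a), q) is nonzero. *)
Lemma tilting_step_odd j b a : n = (2 * j).+1 -> S (b, a) -> 0 < b -> a < b + l ->
  j * l < b /\ S (b - j * l - 1, a - j * l - 1).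
Proof.
move=> nE Sp b0 abl; have /and3P[/= ba am _] := it_interval tS Sp.
have := tilting_syz_gt0 Sp b0 abl (leqnn n); rewrite {1}nE syz_odd => gt0.
split; first lia.
apply: (it_right tS); first by rewrite /interval /=; lia.
move=> [b' a'] i Sq /andP[i0 lt]; apply/negP => E.
have [p ip] := ext_index i0.
suff : ext_nonzero l (n - i) (b, a) (b', a') by apply/negP/(it_rigid tS Sp Sq); lia.
case: ip E => ip; rewrite ip.
  (* [r] indexes the complementary degree [n - i]. Writing [j] as a sum lets the products with [l]
     be expanded, so that only linear arithmetic remains. *)
  have [r jE] : exists r, j = p + r + 1 by exists (j - p - 1); lia.
  have -> : n - (2 * p).+1 = (2 * r).+2 by lia.
  by rewrite ext_odd ext_even; move: gt0; rewrite jE !mulnDl mul1n; lia.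
have [r jE] : exists r, j = p + r + 1 by exists (j - p - 1); lia.
have -> : n - (2 * p).+2 = (2 * r).+1 by lia.
by rewrite ext_odd ext_even; move: gt0; rewrite jE !mulnDl mul1n; lia.
Qed.

Lemma tilting_step_even j b a : n = 2 * j -> S (b, a) -> 0 < b -> a < b + l ->
  j * l < a /\ S (a - j * l - 1, b + l - j * l - 1).
Proof.
move=> nE Sp b0 abl; have /and3P[/= ba am _] := it_interval tS Sp.
have := tilting_syz_gt0 Sp b0 abl (leqnn n); rewrite {1}nE syz_even => gt0.
have [j' jj] : exists j', j = j' + 1 by exists (j - 1); lia.
split; first lia.
apply: (it_right tS); first by rewrite /interval /=; rewrite jj mulnDl mul1n in gt0 *; lia.
move=> [b' a'] i Sq /andP[i0 lt]; apply/negP => E.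
have [p ip] := ext_index i0.
suff : ext_nonzero l (n - i) (b, a) (b', a') by apply/negP/(it_rigid tS Sp Sq); lia.
case: ip E => ip; rewrite ip.
  have [r jE] : exists r, j = p + r + 1 by exists (j - p - 1); lia.
  have -> : n - (2 * p).+1 = (2 * r).+1 by lia.
  by rewrite !ext_odd; move: gt0; rewrite jE !mulnDl mul1n; lia.
have [r jE] : exists r, j = p + r + 2 by exists (j - p - 2); lia.
have -> : n - (2 * p).+2 = (2 * r).+2 by lia.
by rewrite !ext_even; move: gt0; rewrite jE !mulnDl mul2n -addnn; lia.
Qed.

(** Each step preserves the length, which is less than [l], so the orbit goes on until the lower end
    is 0. *)
Lemma tilting_orbit_odd j b a : n = (2 * j).+1 -> S (b, a) -> a < b + l ->
  exists k, b = k * (j * l + 1).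
Proof.
move=> nE; have [N] := ubnP b; elim: N => // N IH in b a *; rewrite ltnS => le Sp abl.
have /and3P[/= ba am _] := it_interval tS Sp.
have [->|b0] := posnP b; first by exists 0.
have [lt Sp'] := tilting_step_odd nE Sp b0 abl.
have [||k kE] := IH _ _ _ Sp'; [lia|lia|].
exists k.+1; rewrite mulSn; lia.
Qed.

(** The two alternatives are the parities of the number of steps: after an even number the lower end
    is a translate of [b], after an odd number a translate of [a]. *)
Lemma tilting_orbit_even j b a : n = 2 * j -> S (b, a) -> a < b + l ->
  (exists k, b = k * (2 * (j * l) - l + 2)) \/
  (exists k, a = j * l + 1 + k * (2 * (j * l) - l + 2)).
Proof.
move=> nE; have [N] := ubnP a; elim: N => // N IH in b a *; rewrite ltnS => le Sp abl.
have /and3P[/= ba am _] := it_interval tS Sp.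
have [->|b0] := posnP b; first by left; exists 0.
have [lt Sp'] := tilting_step_even nE Sp b0 abl.
have [a1|a1] := posnP (a - j * l - 1).
  by right; exists 0; lia.
have [|lt' Sp''] := tilting_step_even nE Sp' a1; first lia.
have jl : l <= j * l by rewrite leq_pmull //; lia.
by have [||[k kE]|[k kE]] := IH _ _ _ Sp''; [lia|lia|left|right];
  exists k.+1; rewrite mulSn; lia.
Qed.

Lemma tilting_arith : 3 <= m ->
  (l = 2 /\ exists k, m = n * k + 1) \/
  (~~ odd n /\ exists k, m = n./2 * l + 1 + k * (n * l - l + 2)).
Proof.
move=> m3.
have S1 : S (m - 1, m) by apply: tilting_inj; rewrite ?/interval /=; lia.
have S2 : 3 <= l -> S (m - 2, m).
  by move=> l3; apply: tilting_inj; rewrite ?/interval /=; lia.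
have gcd1 D k k' : 2 <= D -> m - 1 = k * D -> m - 2 = k' * D -> False.
  move=> D2 e e'; have d2 : D %| m - 2 by rewrite e' dvdn_mull.
  have : D %| m - 2 + 1 by rewrite (_ : m - 2 + 1 = m - 1) ?e ?dvdn_mull //; lia.
  by rewrite dvdn_addr // dvdn1 => /eqP; lia.
have := odd_double_half n; rewrite -muln2 mulnC; set j := n./2.
have [o|e] := boolP (odd n) => nE.
  left; have {}nE : n = (2 * j).+1 by lia.
  have [|k kE] := tilting_orbit_odd nE S1; first lia.
  have [l3|] := leqP 3 l; last first.
    by move=> l3; have lE : l = 2 by [lia]; split=> //; exists k; rewrite lE in kE; lia.
  have [|k' k'E] := tilting_orbit_odd nE (S2 l3); first lia.
  exfalso; apply: (gcd1 _ _ _ _ kE k'E).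
  suff : l <= j * l by lia.
  by rewrite leq_pmull //; lia.
have {}nE : n = 2 * j by lia.
have nlE : n * l = 2 * (j * l) by rewrite nE mulnA.
have jl : l <= j * l by rewrite leq_pmull //; lia.
have [|[k kE]|[k kE]] := tilting_orbit_even nE S1; first lia; last first.
  by right; split=> //; exists k; rewrite nlE.
have [l3|] := leqP 3 l; last first.
  (* For [l = 2] the period is [4j = 2n], whence the factor 2 in the witness. *)
  move=> l3; have lE : l = 2 by [lia]; left; split=> //; exists (2 * k).
  by rewrite lE in kE; rewrite nE; lia.
have [|[k' k'E]|[k' k'E]] := tilting_orbit_even nE (S2 l3); first lia; last first.
  by right; split=> //; exists k'; rewrite nlE.
by exfalso; apply: (gcd1 _ _ _ _ kE k'E); lia.
Qed.

End Necessity.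

(* The duality [x |-> m - x] of the linear quiver. *)
Lemma ext_dual m l i b a b' a' : interval m l (b, a) -> interval m l (b', a') -> 0 < i ->
  ext_nonzero l i (m - a', m - b') (m - a, m - b) = ext_nonzero l i (b, a) (b', a').
Proof.
move=> /and3P[/= h1 h2 h3] /and3P[/= h4 h5 h6] /ext_index[p []] ->.
  by rewrite !ext_odd; lia.
by rewrite !ext_even; lia.
Qed.

(** The duality reverses the arguments of Ext, so for a set stable under it the left maximality
    condition follows from the right one. *)
Lemma dual_tilting m l n (S : nat * nat -> Prop) :
  (forall p, S p -> interval m l p) ->
  (forall b a, S (b, a) -> S (m - a, m - b)) ->
  (forall p q i, S p -> S q -> 0 < i < n -> ~~ ext_nonzero l i p q) ->
  (forall p, interval m l p ->
    (forall q i, S q -> 0 < i < n -> ~~ ext_nonzero l i q p) -> S p) ->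
  interval_tilting m l n S.
Proof.
move=> SI Sd Sr Srt; split=> // -[b a] pI H; have /and3P[/= ba am abl] := pI.
have -> : (b, a) = (m - (m - b), m - (m - a)) by congr pair; lia.
apply: (Sd); apply: Srt; first by rewrite /interval /=; lia.
move=> [b' a'] i Sq lt; have /and3P[/= ba' am' abl'] := SI _ Sq.
rewrite -(@ext_dual m); [|by rewrite /interval /=; lia|by rewrite /interval /=; lia|lia].
rewrite (_ : m - (m - b) = b); last lia.
rewrite (_ : m - (m - a) = a); last lia.
by apply: H lt; apply: Sd.
Qed.

(** * Construction of tilting sets *)

Lemma ext_full_l l i b b' a' : 0 < i -> ~~ ext_nonzero l i (b, b + l) (b', a').
Proof.
by move=> /ext_index[p []] ->; [rewrite ext_odd | rewrite ext_even]; lia.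
Qed.

Lemma ext_full_r l i b a b' : 0 < i -> ~~ ext_nonzero l i (b, a) (b', b' + l).
Proof.
by move=> /ext_index[p []] ->; [rewrite ext_odd | rewrite ext_even]; lia.
Qed.

Lemma ext_simple i b b' : 0 < i -> ext_nonzero 2 i (b, b + 1) (b', b' + 1) = (b == b' + i).
Proof. by move=> /ext_index[p []] ->; [rewrite ext_odd | rewrite ext_even]; lia. Qed.

(** By [ext_simple], Ext between simples sees only their distance. Simples at multiples of [n] are
    too far apart to interact in degrees below [n], whereas any other simple is less than [n] below
    one of them. As [m - 1] is a multiple of [n], the set is self-dual. *)
Lemma radical_square_zero_tilting m n k : 2 <= n -> m = n * k + 1 ->
  exists S, interval_tilting m 2 n S.
Proof.
move=> n2 mE.
exists (fun p => interval m 2 p /\ (p.2 = p.1 + 2 \/ (p.2 = p.1 + 1 /\ n %| p.1))).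
apply: dual_tilting.
- by move=> p [].
- move=> b a [/and3P[/= h1 h2 h3] h]; split; first by rewrite /interval /=; lia.
  case: h => [h|[h dv]]; [left|right]; rewrite /=; first lia.
  split; first lia.
  rewrite (_ : m - a = n * k - b); last lia.
  by rewrite dvdn_sub // dvdn_mulr.
- move=> [b a] [b' a'] i [_ /= h] [_ /= h'] /andP[i0 lt].
  case: h => [->|[-> dv]]; first exact: ext_full_l.
  case: h' => [->|[-> dv']]; first exact: ext_full_r.
  rewrite ext_simple //; apply/eqP => e.
  by move: dv; rewrite e dvdn_addr // => /(dvdn_leq i0); lia.
move=> [b a] pI H; split=> //=; have /and3P[/= h1 h2 h3] := pI.
have [aE|aE] : a = b + 2 \/ a = b + 1 by [lia]; [by left|right; split=> //].
apply: contrapT => /negP nd.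
have bE := divn_eq b n; have bm : b %% n < n by rewrite ltn_mod; lia.
have b0 : 0 < b %% n by rewrite lt0n.
(* The least multiple of [n] above [b]; it does not exceed [n * k = m - 1], so the simple there
   exists. *)
set c := (b %/ n).+1 * n.
have cE : c = b %/ n * n + n by rewrite /c mulSn addnC.
have cm : c <= n * k.
  have bk : b != n * k by apply: contra nd => /eqP ->; apply: dvdn_mulr.
  rewrite /c mulnC leq_pmul2l ?ltn_divLR // ?(mulnC k); lia.
have := H (c, c + 1) (c - b); rewrite aE ext_simple; last lia.
rewrite (_ : c == b + (c - b)); last by apply/eqP; lia.
suff h : interval m 2 (c, c + 1) /\
    (c + 1 = c + 2 \/ c + 1 = c + 1 /\ n %| c) by move=> /(_ h) /(_ ltac:(lia)).
split; first by rewrite /interval /=; lia.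
by right; split=> //; apply: dvdn_mull.
Qed.

(* For [0 <= r <= k] put [R = r D] and [M = R + j l + 1]. The intervals shorter
   than [l] with socle end [R] or top end [M], together with those of length
   [l], form the tilting set: those ending in [M] exclude exactly the other
   intervals with [R < b] and [a < M], and those starting in [R + D] exclude the
   ones with [b < R + D] and [M < a]. *)
Lemma even_tilting m l j k (D := 2 * (j * l) - l + 2) : 2 <= l -> 0 < j ->
  m = j * l + 1 + k * D -> exists S, interval_tilting m l (2 * j) S.
Proof.
move=> l2 j0 mE.
have jl : l <= j * l by rewrite leq_pmull.
have DE : D + l = 2 * (j * l) + 2 by rewrite /D; lia.
have Dlt r s : r < s -> r * D + D <= s * D by move=> rs; rewrite addnC -mulSn leq_mul2r rs orbT.
have Dle r x : x = r * D -> x < m -> r <= k /\ k * D = (k - r) * D + r * D.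
  move=> xE xm; have rk : r <= k by rewrite leqNgt; apply/negP => /Dlt; lia.
  by rewrite -mulnDl subnK.
exists (fun p => interval m l p /\ (p.2 = p.1 + l \/
   ((exists r, p.1 = r * D) \/ (exists r, p.2 = r * D + j * l + 1)))).
apply: dual_tilting.
- by move=> p [].
- move=> b a [/and3P[/= h1 h2 h3] h]; split; first by rewrite /interval /=; lia.
  case: h => [h|[[r h]|[r h]]]; [left|right;right|right;left] => /=; first lia.
    have [rk e] := Dle _ _ h (leq_trans h1 h2).
    by exists (k - r); lia.
  have [||rk e] := Dle r (r * D); [by []|lia|].
  by exists (k - r); lia.
- move=> [b a] [b' a'] i [/and3P[/= h1 h2 h3] h] [/and3P[/= h4 h5 h6] h'] /andP[i0 lt].
  case: h => [->|h]; first exact: ext_full_l.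
  case: h' => [->|h']; first exact: ext_full_r.
  have [bl|bl] := eqVneq a (b + l); first by rewrite bl; apply: ext_full_l.
  have [bl'|bl'] := eqVneq a' (b' + l); first by rewrite bl'; apply: ext_full_r.
  have key : exists r s, (b = r * D \/ a = r * D + j * l + 1) /\
                         (b' = s * D \/ a' = s * D + j * l + 1).
    case: h => [[r h]|[r h]]; case: h' => [[s h']|[s h']]; exists r, s; lia.
  have {h h'} [r [s [h h']]] := key.
  (* Two multiples of [D] agree or are at least [D] apart. Rigidity needs no more about them, so
     they can be generalized to [R] and [T]. *)
  have rs : r * D = s * D \/ r * D + D <= s * D \/ s * D + D <= r * D.
    case: (ltngtP r s) => [/Dlt|/Dlt|->]; lia.
  move: (r * D) (s * D) rs h h' => R T rs h h'.
  have [p [ip|ip]] := ext_index i0; rewrite ip in lt *.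
    have pj : p * l + l <= j * l by rewrite addnC -mulSn leq_mul2r; lia.
    by rewrite ext_odd; apply/negP => /and4P[]; lia.
  have pj : p.+2 * l <= j * l by rewrite leq_mul2r; lia.
  rewrite !mulSn in pj.
  by rewrite ext_even; apply/negP => /and4P[]; lia.
move=> [b a] pI H; split=> //=; have /and3P[/= h1 h2 h3] := pI.
have [bl|bl] := eqVneq a (b + l); [by left|right].
have bE := divn_eq b D; have bm : b %% D < D by rewrite ltn_mod; lia.
move: (b %/ D) bE => r bE.
have [b0|b0] := posnP (b %% D); first by left; exists r; lia.
have [aE|aE] := eqVneq a (r * D + j * l + 1); first by right; exists r.
exfalso.
have rk : r <= k by rewrite leqNgt; apply/negP => /Dlt; lia.
have rkD : r * D <= k * D by rewrite leq_mul2r rk orbT.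
have [le|gt] := leqP a (r * D + j * l).
  (* [t] numbers the block of [l] consecutive positions above [r * D] that contains [b]. If [a] does
     not leave the block, an odd Ext works, with [d] chosen so that the lower end of the test
     interval is a shift of [a] by a multiple of [l]; otherwise an even Ext works, with a shift of
     [b] instead. *)
  have tE := divn_eq (b - r * D - 1) l.
  have tm : (b - r * D - 1) %% l < l by rewrite ltn_mod; lia.
  move: (_ %/ _) (_ %% _) tE tm => t e tE tm.
  have kill d i : d < l -> 0 < d -> 0 < i < 2 * j ->
      ~~ ext_nonzero l i (r * D + j * l + 1 - d, r * D + j * l + 1) (b, a).
    move=> d1 d0; apply: H; split; first by rewrite /interval /=; lia.
    by right; right; exists r.
  have tj : t < j by rewrite -(@ltn_pmul2r l); lia.
  have [inside|straddle] := ltnP a (r * D + t * l + l + 1).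
    have [p jE] : exists p, j = t + p + 1 by exists (j - t - 1); lia.
    have := @kill (r * D + t * l + l + 1 - a) (2 * p).+1.
    by rewrite ext_odd jE !mulnDl mul1n; lia.
  have tj' : t.+1 < j by rewrite -(@ltn_pmul2r l) ?mulSn; lia.
  have [p jE] : exists p, j = t + p + 2 by exists (j - t - 2); lia.
  have := @kill (r * D + t * l + l + 1 - b) (2 * p).+2.
  by rewrite ext_even jE !mulnDl mul2n -addnn; lia.
(* For [r = k] the number [r * D + j * l + 1] is [m], which [a] cannot exceed. *)
have {}rk : r < k.
  by rewrite ltnNge; apply/negP => kr; have := leq_mul2r D k r; rewrite kr orbT; lia.
have {}rkD := Dlt _ _ rk.
(* Now the blocks are counted downwards from [r * D + D], and [d] adjusts the upper end of the test
   interval: one more than the shift of [a] by [t * l] for an odd Ext, equal to its shift by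
   [t * l + l] for an even one. *)
have tE := divn_eq (r * D + D - b - 1) l.
have tm : (r * D + D - b - 1) %% l < l by rewrite ltn_mod; lia.
move: (_ %/ _) (_ %% _) tE tm => t e tE tm.
have kill d i : d < l -> 0 < d -> 0 < i < 2 * j ->
    ~~ ext_nonzero l i (r * D + D, r * D + D + d) (b, a).
  move=> d1 d0; apply: H; split; first by rewrite /interval /=; lia.
  by right; left; exists r.+1; rewrite mulSn addnC.
have [straddle|inside] := leqP (r * D + D) (a + t * l).
  have tj : t < j.
    by rewrite ltnNge; apply/negP => jt; have := leq_mul2r l j t; rewrite jt orbT; lia.
  have := @kill (a + t * l + 1 - (r * D + D)) (2 * t).+1.
  by rewrite ext_odd; lia.
have tj : t.+1 < j by rewrite -(@ltn_pmul2r l) ?mulSn; lia.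
have := @kill (a + t * l + l - (r * D + D)) (2 * t).+2.
by rewrite ext_even; lia.
Qed.

Theorem theorem2 (K : fieldType) (m l n : nat)
    (hm : 3 <= m) (hl : 2 <= l) (hn : 2 <= n)
    (hgl : le_gldim (Lambda K m l) n) :
  admits_cluster_tilting (Lambda K m l) n <->
    (l = 2 /\ exists k : nat, m = n * k + 1) \/
    (~~ odd n /\ exists k : nat, m = n./2 * l + 1 + k * (n * l - l + 2)).
Proof.
rewrite cluster_tilting_intervals; split=> [[S tS]|[[-> [k mE]]|[en [k mE]]]].
- exact: tilting_arith hl hn tS hm.
- exact: radical_square_zero_tilting hn mE.
have nE : n = 2 * n./2 by rewrite mul2n even_halfK.
rewrite nE; apply: (@even_tilting m l n./2 k) => //; first lia.
by rewrite mulnA -nE.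
Qed.
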